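(* Let $u(t)$ be the control defined by $u(t)=u^j$ for $t\in[t_{j-1},t_j)$, $j=1,\dots,N$, with some parameters $N\ge 1$, $\{u^1,u^2,\dots,u^N\}\subset U$, $0=t_0<t_1<t_2<\dots<t_N=\tau$, and let $x(t)$, $t\in[0,\tau]$, be the corresponding solution of the control system $\dot x=f_0(x)+\sum_{j=1}^m u_j g_j(x)$ with initial data $x(0)=x^0\in X$. If the isoperimetric constraint $$\frac1\tau\int_0^\tau u_1(t)\,dt=\bar u_1$$ and the periodic boundary condition $$x^0=x(0)=x(\tau)$$ are satisfied, then $$\sum_{i=1}^N\tau_i u_1^i=\tau\bar u_1,\qquad \tau_i=t_i-t_{i-1}>0,$$ and $$\sum_{i=1}^N\left(\tau_i f_i+\frac{\tau_i^2}{2}L_{f_i}f_i\right)+\sum_{1\le j<i\le N}\tau_i\tau_j L_{f_j}f_i+\sum_{i,j,l=1}^N\int_{t_{l-1}}^{t_l}V_{ij}(t)\,dt\;L_{f_j}L_{f_i}f_l=O(\tau^4),$$ where $$2V_{ii}(t)=\begin{cases}0,&t\le t_{i-1},\\ (t-t_{i-1})^2,&t\in(t_{i-1},t_i),\\ \tau_i^2,&t\ge t_i,\end{cases}\qquad V_{ij}(t)=0\ \text{ for } i<j,$$ $$V_{ij}(t)=\begin{cases}0,&t\le t_{i-1},\\ (t-t_{i-1})\tau_j,&t\in(t_{i-1},t_i),\\ \tau_i\tau_j,&t\ge t_i,\end{cases}\qquad\text{for } i>j.$$ Moreover, the cost $J[x]=\frac1\tau\int_0^\tau x_1(t)\,dt$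 is equal to $\bar x_1$ (the first component of $\bar x$), where $$\begin{aligned}\bar x=\frac1\tau\int_0^\tau x(t)\,dt={}&x^0+\frac1{2\tau}\sum_{i=1}^N\tau_i\left(\tau_i+2(\tau-t_i)\right)f_i+\frac1{6\tau}\sum_{i=1}^N\tau_i^2\left(\tau_i+3(\tau-t_i)\right)L_{f_i}f_i\\&+\frac1{2\tau}\sum_{1\le j<i\le N}\tau_i\tau_j\left(\tau_i+2(\tau-t_i)\right)L_{f_j}f_i+O(\tau^3).\end{aligned}$$ All vector fields $f_i$, $L_{f_j}f_i$, $L_{f_j}L_{f_i}f_l$ in these formulas are evaluated at $x=x^0$.
   Context: Setting: the control-affine system $\dot x=f_0(x)+\sum_{j=1}^m u_jg_j(x)$, $x=(x_1,\dots,x_n)^T\in X$, $u=(u_1,\dots,u_m)^T\in U$, where $X\subset\mathbb R^n$ is a domain, $f_0,g_1,\dots,g_m$ are smooth vector fields on $X$, $U\subset\mathbb R^m$ is compact, $(0,0)\in X\times U$ and $f_0(0)=0$. The number $\bar u_1\in\mathbb R$ is given and $\tau>0$ is the time horizon. For control values $u^j=(u^j_1,\dots,u^j_m)^T\in U$, define the vector fields $f_j(x)=f_0(x)+\sum_{i=1}^m u_i^j g_i(x)$, $j=1,\dots,N$. For a vector field $f$ and a smooth map $h$ (in particular, a vector field regarded as a map $X\to\mathbb R^n$), $L_fh(x)=\frac{\partial h(x)}{\partial x}f(x)$, where $\frac{\partial h}{\partial x}$ is the Jacobian matrix; iterated derivatives are $L_{f_j}L_{f_i}f_l=L_{f_j}(L_{f_i}f_l)$.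 Asymptotic notation is for small positive argument: $\phi(t)=O(t^k)$ if and only if $\limsup_{t\downarrow0}|\phi(t)|t^{-k}<\infty$. The relations are understood as $\tau\downarrow0$, with the system, $N$, the values $u^1,\dots,u^N$ and $x^0$ fixed, and with the switching times $t_i$ (subject to $0=t_0<\dots<t_N=\tau$) allowed to depend on $\tau$, over those $\tau$ for which the hypotheses hold. *)

(* Defs.v *)
From HB Require Import structures.
From mathcomp Require Import all_boot all_order all_algebra.
From mathcomp Require Import all_classical all_reals all_analysis.
Import Order.TTheory GRing.Theory Num.Theory.
Import numFieldNormedType.Exports.

Set Implicit Arguments.
Unset Strict Implicit.
Unset Printing Implicit Defensive.

Local Open Scope classical_set_scope.
Local Open Scope ring_scope.

                                                                              
                                                                      

Fixpoint Ck_on (R : realType) (n p : nat) (k : nat) (X : set 'rV[R]_n)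
    (f : 'rV[R]_n -> 'rV[R]_p) : Prop :=
  match k with
  | 0%N => forall y, X y -> {for y, continuous f}
  | k'.+1 => (forall y, X y -> differentiable f y) /\
             (forall w : 'rV[R]_n, Ck_on k' X (fun y => 'D_w f y))
  end.

Definition smooth_on (R : realType) (n p : nat) (X : set 'rV[R]_n)
    (f : 'rV[R]_n -> 'rV[R]_p) : Prop :=
  forall k, Ck_on k X f.

                                                                               
                                                      
Definition Lie (R : realType) (n p : nat) (f : 'rV[R]_n -> 'rV[R]_n)
    (h : 'rV[R]_n -> 'rV[R]_p) : 'rV[R]_n -> 'rV[R]_p :=
  fun y => f y *m jacobian h y.

Definition affine_field (R : realType) (n m : nat)
    (f0 : 'rV[R]_n -> 'rV[R]_n) (g : 'I_m -> 'rV[R]_n -> 'rV[R]_n)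
    (w : 'rV[R]_m) : 'rV[R]_n -> 'rV[R]_n :=
  fun y => f0 y + \sum_(i < m) w 0 i *: g i y.

Definition switching_times (R : realType) (N : nat) (tau : R) (t : nat -> R)
    : Prop :=
  [/\ t 0%N = 0, (forall j, (j < N)%N -> t j < t j.+1) & t N = tau].

                                                                                 
                                                                                
Definition pw_constant (R : realType) (m N : nat) (t : nat -> R)
    (v : 'I_N -> 'rV[R]_m) : R -> 'rV[R]_m :=
  fun s => \sum_(j < N) (if t j <= s < t j.+1 then v j else 0).

                                                                               
                                                                        
Definition is_solution (R : realType) (n m : nat) (X : set 'rV[R]_n.+1)
    (f0 : 'rV[R]_n.+1 -> 'rV[R]_n.+1)
    (g : 'I_m -> 'rV[R]_n.+1 -> 'rV[R]_n.+1)
    (u : R -> 'rV[R]_m) (tau : R) (x : R -> 'rV[R]_n.+1) : Prop :=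
  [/\ {within `[0, tau], continuous x},
      forall s, s \in `[0, tau] -> X (x s) &
      exists E : seq R, forall s, s \in `]0, tau[ -> s \notin E ->
        is_derive s 1 x (affine_field f0 g (u s) (x s))].

Definition time_mean (R : realType) (tau : R) (phi : R -> R) : R :=
  tau^-1 * \int[lebesgue_measure]_(s in `[0, tau]) phi s.

Definition duration (R : realType) (t : nat -> R) (i : nat) : R :=
  t i.+1 - t i.

Definition Vcoef (R : realType) (t : nat -> R) (i j : nat) (s : R) : R :=
  if (i < j)%N then 0
  else if i == j then
    2^-1 * (if s <= t i then 0
            else if s < t i.+1 then (s - t i) ^+ 2
            else duration t i ^+ 2)
  else
    (if s <= t i then 0
     else if s < t i.+1 then (s - t i) * duration t j
     else duration t i * duration t j).

(* Main.v *)
Require Import Defs.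
From HB Require Import structures.
From mathcomp Require Import all_boot all_order all_algebra.
From mathcomp Require Import all_classical all_reals all_analysis.
From mathcomp Require Import ring.
Import Order.TTheory GRing.Theory Num.Theory.
Import numFieldNormedType.Exports.

Local Open Scope classical_set_scope.
Local Open Scope ring_scope.

(** Let [f l] be the field that drives the system on the interval
    [[t l, t l.+1[], and let [a_l] be the indicator of that interval.  An
    observable [h] changes along the trajectory at the rate
    [sum_l a_l(s) (L_l h)(x(s))], where [L_l] is the Lie derivative along
    [f l].  Expanding [L_l h] in the same way, and again, gives the Chen-Fliess
    series
    [h(x(s)) = h + sum_i W_i(s) L_i h + sum_ij V_ij(s) L_j L_i h
               + sum_ijl T_ijl(s) L_j L_i L_l h + O(s^4)],
    with all Lie derivatives taken at [x(0)] and with iterated integrals as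
    coefficients: [W_i' = a_i], [V_ij' = a_i W_j] and [T_ijl' = a_l V_ij].  Since
    the switching intervals are disjoint and ordered, [W_i] is a clamped affine
    function and [V_ij] is a polynomial in [W_i]; it is the given [Vcoef], and
    [T_ijl(tau)] is its integral over the [l]-th interval.

    For [h = id] and [s = tau] the two ends of the trajectory cancel by
    periodicity, so that the sum of the remaining terms equals the remainder:
    this is [endpoint_expansion].  For the time mean, the expansion of [x(s)] up
    to [O(s^3)] is integrated once more over [[0, tau]] and divided by [tau]:
    this is [time_mean_expansion].

    Each order is gained by a mean value inequality and not by manipulating
    iterated integrals of the solution: two functions that agree at [0] and
    whose derivatives differ by at most [C s^q] differ by at most [C s^(q+1)]
    ([primitive_comparison], and [Lie_expansion_step] along a trajectory).  The
    constant [C] is the same at all orders: it bounds the longest Lie derivative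
    that occurs.  The remainder is uniform because a trajectory that lasts less
    than some [delta] cannot leave a ball around [x(0)] on which the finitely
    many fields and Lie derivatives involved are bounded; [delta] and the bound
    depend on neither the switching times nor the duration
    ([short_trajectory_bounds]). *)

Set Implicit Arguments.
Unset Strict Implicit.
Unset Printing Implicit Defensive.

(** * Smooth maps and Lie derivatives *)

(** The linear part of [f] is also one for [g], and a linear part is unique, so
    it is the differential of [g]. *)
Lemma near_eq_differentiable (R : realType) (V W : normedModType R)
    (f g : V -> W) (a : V) :
  {near a, f =1 g} -> differentiable f a -> differentiable g a.
Proof.
move=> fg df; have [dc fE] := (diff_locallyP a f).1 df.
have gE : g \o shift a = cst (g a) + 'd f a +o_ (0 : V) id.
  apply/eqaddoP => e e0; move/eqaddoP : fE => /(_ e e0).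
  have : \forall h \near (0 : V), f (h + a) = g (h + a).
    by move: fg; rewrite (near_shift (0 : V)) /= subr0.
  apply: filter_app2; near=> h => fgh.
  by rewrite !fctE /= fgh (nbhs_singleton fg).
by apply/diff_locallyP; rewrite (diff_unique dc gE).
Unshelve. all: by end_near. Qed.

(** Derivatives inside an open set see the values in that set only.  This allows
    the differentiation rules below to be used although they hold on [X] and not
    everywhere. *)
Lemma Ck_on_ext (R : realType) (n p k : nat) (X : set 'rV[R]_n)
    (f g : 'rV[R]_n -> 'rV[R]_p) :
  open X -> {in X, f =1 g} -> Ck_on k X f -> Ck_on k X g.
Proof.
move=> oX; elim: k f g => [|k IH] f g fg;
    have fgn y : X y -> {near y, f =1 g} by
      move=> Xy; apply: filterS (open_nbhs_nbhs (conj oX Xy)) => z Xz;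
      apply: fg; rewrite inE.
  move=> fc y Xy; rewrite /prop_for /continuous_at -(nbhs_singleton (fgn _ Xy)).
  exact: cvg_trans (near_eq_cvg (fgn _ Xy)) (fc _ Xy).
case=> df Df; split=> [y Xy|w]; last first.
  by apply: IH (Df w) => y; rewrite inE => Xy; exact: near_eq_derive (fgn _ Xy).
exact: near_eq_differentiable (fgn _ Xy) (df _ Xy).
Qed.

Lemma Ck_onW (R : realType) (n p k : nat) (X : set 'rV[R]_n)
    (f : 'rV[R]_n -> 'rV[R]_p) : Ck_on k.+1 X f -> Ck_on k X f.
Proof.
elim: k f => [|k IH] f; first by case=> df _ y /df/differentiable_continuous.
by case=> df Df; split=> // w; exact: IH.
Qed.

(** Scaling is a continuous bilinear map, whose differential is known. *)
Lemma differentiable_scale (R : realType) (V W : normedModType R)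
  (a : V -> R) (b : V -> W) x : differentiable a x -> differentiable b x ->
  differentiable (fun y => a y *: b y) x /\
  forall w, 'D_w (fun y => a y *: b y) x = 'D_w a x *: b x + a x *: 'D_w b x.
Proof.
move=> da db.
have bil : bilinear_for
    (GRing.Scale.Law.clone _ _ *:%R _) (GRing.Scale.Law.clone _ _ *:%R _)
    (@GRing.scale R W).
  by split=> [u'|u] c y z /=; rewrite ?scalerDl ?scalerDr ?scalerA // mulrC.
pose bm := bilinear_isBilinear.Build R R W W _ _ (@GRing.scale R W) bil.
pose bl : {bilinear R -> W -> W} := HB.pack (@GRing.scale R W) bm.
have cs : continuous (fun p : R * W => bl p.1 p.2).
  by move=> p; exact: scale_continuous.
have dab := differentiable_pair da db.
have ds := @differentiable_bilin _ _ _ _ bl (a x, b x) cs.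
have E : (fun y => a y *: b y) =
    (fun p : R * W => bl p.1 p.2) \o (fun y => (a y, b y)) by [].
have dd : differentiable (fun y => a y *: b y) x.
  by rewrite E; apply: differentiable_comp.
have dE := @diff_bilin _ _ _ _ bl (a x, b x) cs.
split=> // w; rewrite !deriveE// E (diff_comp dab ds) dE diff_pair//=.
by rewrite addrC.
Qed.

Lemma Ck_onD (R : realType) (n p k : nat) (X : set 'rV[R]_n)
    (f g : 'rV[R]_n -> 'rV[R]_p) : open X ->
  Ck_on k X f -> Ck_on k X g -> Ck_on k X (fun y => f y + g y).
Proof.
move=> oX; elim: k f g => [|k IH] f g.
  by move=> cf cg y Xy; exact: (@continuousD _ _ _ f g y (cf _ Xy) (cg _ Xy)).
move=> [df Df] [dg Dg]; split=> [y Xy|w].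
  by apply: differentiableD; [exact: df|exact: dg].
apply: (Ck_on_ext oX _ (IH _ _ (Df w) (Dg w))) => y; rewrite inE => Xy.
by rewrite -deriveD //; apply: diff_derivable; [exact: df|exact: dg].
Qed.

Lemma Ck_on_cst (R : realType) (n p k : nat) (X : set 'rV[R]_n)
  (c : 'rV[R]_p) : Ck_on k X (fun=> c).
Proof.
elim: k c => [|k IH] c; first by move=> y _; exact: cst_continuous.
split=> [y _|w]; first exact: differentiable_cst.
rewrite (_ : (fun y => 'D_w _ y) = fun=> 0); first exact: IH.
by apply/funext => y; exact: derive_cst.
Qed.

Lemma derive_coord (R : realType) (V : normedModType R) (p : nat)
    (f : V -> 'rV[R]_p) (i : 'I_p) y :
  differentiable f y ->
  differentiable (fun z => f z 0 i) y /\
  forall w, 'D_w (fun z => f z 0 i) y = 'D_w f y 0 i.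
Proof.
move=> df; have dc := differentiable_coord (f y) 0 i.
have E : (fun z => f z 0 i) = (fun N : 'rV[R]_p => N 0 i) \o f by [].
have dd : differentiable (fun z => f z 0 i) y.
  by rewrite E; apply: differentiable_comp.
split=> // w; rewrite !deriveE// E diff_comp//=.
have @c : {linear 'rV[R]_p -> R}.
  by exists (fun N : 'rV[R]_p => N 0 i); do 2![eexists]; do ?[constructor];
     rewrite ?mxE// => ? *; rewrite ?mxE//; move=> ?; rewrite !mxE.
rewrite (_ : (fun N : 'rV[R]_p => N 0 i) = c)// diff_lin//.
exact: coord_continuous.
Qed.

(** The Leibniz rule keeps products of this shape within sums of such products,
    so one induction on [k] is enough. *)
Lemma Ck_on_scale_coord (R : realType) (n p q k : nat) (X : set 'rV[R]_n)
    (a : 'rV[R]_n -> 'rV[R]_q) (i : 'I_q) (b : 'rV[R]_n -> 'rV[R]_p) : open X ->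
  Ck_on k X a -> Ck_on k X b -> Ck_on k X (fun y => a y 0 i *: b y).
Proof.
move=> oX; elim: k a b => [|k IH] a b.
  move=> ca cb y Xy.
  have cai : {for y, continuous (fun z => a z 0 i)}.
    exact: (continuous_comp (ca _ Xy) (@coord_continuous _ _ _ 0 i (a y))).
  exact: (@continuousZ _ _ _ (fun z => a z 0 i) b y cai (cb _ Xy)).
move=> Ca Cb; have [da Da] := Ca; have [db Db] := Cb.
split=> [y Xy|w].
  apply: (differentiable_scale _ (db _ Xy)).1.
  exact: (derive_coord i (da _ Xy)).1.
have D := Ck_onD oX (IH _ _ (Da w) (Ck_onW Cb)) (IH _ _ (Ck_onW Ca) (Db w)).
apply: (Ck_on_ext oX _ D) => y; rewrite inE => Xy.
have [di Di] := derive_coord i (da _ Xy).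
by rewrite (differentiable_scale di (db _ Xy)).2 Di.
Qed.

Lemma smooth_on_sum (R : realType) (n p : nat) (X : set 'rV[R]_n) (I : Type)
    (r : seq I) (F : I -> 'rV[R]_n -> 'rV[R]_p) : open X ->
  (forall i, smooth_on X (F i)) -> smooth_on X (fun y => \sum_(i <- r) F i y).
Proof.
move=> oX sF k; elim: r => [|i r IH].
  rewrite (_ : (fun y => \sum_(i <- _) _) = fun=> 0); first exact: Ck_on_cst.
  by apply/funext => y; rewrite big_nil.
rewrite (_ : (fun y => \sum_(i <- _) _) = fun y => F i y + \sum_(j <- r) F j y).
  by apply: Ck_onD => //; exact: (sF i k).
by apply/funext => y; rewrite big_cons.
Qed.

Lemma smooth_on_differentiable (R : realType) (n p : nat) (X : set 'rV[R]_n)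
    (h : 'rV[R]_n -> 'rV[R]_p) :
  smooth_on X h -> forall y, X y -> differentiable h y.
Proof. by move=> sh y Xy; have [dh _] := sh 1%N; exact: dh. Qed.

Lemma LieE (R : realType) (n p : nat) (f : 'rV[R]_n.+1 -> 'rV[R]_n.+1)
    (h : 'rV[R]_n.+1 -> 'rV[R]_p.+1) y :
  differentiable h y -> Lie f h y = 'd h y (f y).
Proof. by move=> dh; rewrite /Lie /jacobian mul_rV_lin1. Qed.

(** In coordinates, the Lie derivative is the sum of the partial derivatives of
    [h] weighted by the coordinates of [f]. *)
Lemma smooth_on_Lie (R : realType) (n p : nat) (X : set 'rV[R]_n.+1)
    (f : 'rV[R]_n.+1 -> 'rV[R]_n.+1) (h : 'rV[R]_n.+1 -> 'rV[R]_p.+1) :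
  open X -> smooth_on X f -> smooth_on X h -> smooth_on X (Lie f h).
Proof.
move=> oX sf sh.
have : smooth_on X (fun y => \sum_i f y 0 i *: 'D_(delta_mx 0 i) h y).
  apply: smooth_on_sum => // i k; have [_ /(_ (delta_mx 0 i)) Dh] := sh k.+1.
  exact: (@Ck_on_scale_coord _ _ _ _ _ _ f i _ oX (sf k) Dh).
move=> s k; apply: (Ck_on_ext oX _ (s k)) => y; rewrite inE => Xy.
have dh := smooth_on_differentiable sh Xy.
rewrite LieE// [in RHS](row_sum_delta (f y)) linear_sum; apply: eq_bigr => i _.
by rewrite linearZ/= deriveE.
Qed.

Lemma smooth_on_affine_field (R : realType) (n m : nat) (X : set 'rV[R]_n.+1)
    (f0 : 'rV[R]_n.+1 -> 'rV[R]_n.+1) (g : 'I_m -> 'rV[R]_n.+1 -> 'rV[R]_n.+1)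
    (w : 'rV[R]_m) : open X -> smooth_on X f0 -> (forall i, smooth_on X (g i)) ->
  smooth_on X (affine_field f0 g w).
Proof.
move=> oX s0 sg k; apply: Ck_onD => //.
apply: smooth_on_sum => // i {}k.
exact: (@Ck_on_scale_coord _ _ _ _ _ _ (fun=> w) i (g i) oX
  (Ck_on_cst _ _ _) (sg i k)).
Qed.

Lemma smooth_on_id (R : realType) (n : nat) (X : set 'rV[R]_n) :
  smooth_on X (@id 'rV[R]_n).
Proof.
case=> [|k]; first by move=> y _; exact: (@cvg_id _ (nbhs y)).
split=> [y _|w]; first exact: ex_diff.
rewrite (_ : (fun y => 'D_w _ y) = fun=> w); first exact: Ck_on_cst.
by apply/funext => y; exact: derive_id.
Qed.

Lemma Lie_id (R : realType) (n : nat) (f : 'rV[R]_n.+1 -> 'rV[R]_n.+1) :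
  Lie f id = f.
Proof. by apply/funext => y; rewrite LieE ?diff_val. Qed.

(** * Comparing functions through their derivatives *)

(** Cutting the interval at the points of [E] reduces this to the mean value
    theorem on each piece; continuity joins the pieces. *)
Lemma mean_value_inequality (R : realType) (phi : R -> R) (M : R) (E : seq R)
    (a b : R) :
  a <= b -> {within `[a, b], continuous phi} ->
  (forall s, s \in `]a, b[ -> s \notin E ->
    exists2 d, is_derive s 1 phi d & `|d| <= M) ->
  `|phi b - phi a| <= M * (b - a).
Proof.
rewrite le_eqVlt => /predU1P[<- _ _|]; first by rewrite !subrr normr0 mulr0.
elim: E a b => [|e E IH] a b ab phic phid.
  have [s sab|c cab ->] := @MVT R phi (fun s => 'D_1 phi s) a b ab _ phic.
    by have [//|d ds _] := phid s sab; apply: derivableP; exact: ex_derive.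
  have [//|d dc dM] := phid c cab.
  rewrite normrM derive_val (gtr0_norm (_ : 0 < b - a)) ?subr_gt0//.
  by rewrite ler_wpM2r// subr_ge0 ltW.
have phidE s : s \in `]a, b[ -> s != e -> s \notin E ->
    exists2 d, is_derive s 1 phi d & `|d| <= M.
  by move=> sab se sE; apply: phid => //; rewrite inE negb_or se.
have [eab|eab] := boolP (e \in `]a, b[).
  move: (eab); rewrite in_itv/= => /andP[ae eb].
  have -> : phi b - phi a = (phi b - phi e) + (phi e - phi a) by ring.
  have -> : M * (b - a) = M * (b - e) + M * (e - a) by ring.
  apply: le_trans (ler_normD _ _) _; apply: lerD; apply: IH => //.
  - apply: continuous_subspaceW phic => s /=; rewrite !in_itv/= => /andP[es ->].
    by rewrite (le_trans (ltW ae)).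
  - move=> s; rewrite in_itv/= => /andP[es sb]; apply: phidE.
      by rewrite in_itv/= sb (lt_trans ae).
    by rewrite gt_eqF.
  - apply: continuous_subspaceW phic => s /=; rewrite !in_itv/= => /andP[-> se].
    by rewrite (le_trans se) ?ltW.
  - move=> s; rewrite in_itv/= => /andP[es sb]; apply: phidE.
      by rewrite in_itv/= es (lt_trans sb).
    by rewrite lt_eqF.
apply: IH => // s sab; apply: phidE => //.
by apply: contraNneq eab => <-.
Qed.

(** On [[0, s]] the bound [C * r ^+ p] on the difference of the derivatives is
    largest at [r = s]. *)
Lemma primitive_comparison (R : realType) (Z Q : R -> R) (C tau : R) (p : nat)
    (E : seq R) :
  0 <= C ->
  {within `[0, tau], continuous Z} -> {within `[0, tau], continuous Q} ->
  Z 0 = Q 0 ->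
  (forall s, s \in `]0, tau[ -> s \notin E -> exists dz dq,
     [/\ is_derive s 1 Z dz, is_derive s 1 Q dq & `|dz - dq| <= C * s ^+ p]) ->
  forall s, s \in `[0, tau] -> `|Z s - Q s| <= C * s ^+ p.+1.
Proof.
move=> C0 Zc Qc ZQ0 dZQ s; rewrite in_itv/= => /andP[s0 st].
have cs : {within `[0, s], continuous (Z - Q)}.
  apply: (@continuous_subspaceW _ _ _ `[0, tau]%classic).
    by move=> r /=; rewrite !in_itv/= => /andP[-> /le_trans]; exact.
  exact: within_continuousB.
have := @mean_value_inequality R (Z - Q) (C * s ^+ p) E 0 s s0 cs.
rewrite !fctE ZQ0 subrr !subr0 -mulrA -exprSr; apply=> r.
rewrite in_itv/= => /andP[r0 rs] rE.
have [|dz [dq [Hz Hq b]]] := dZQ r _ rE.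
  by rewrite in_itv/= r0 (lt_le_trans rs).
exists (dz - dq); first exact: is_deriveB.
apply: le_trans b _; by rewrite ler_wpM2l// lerXn2r// ?nnegrE ?ltW.
Qed.

Definition clamp (R : realType) (a b s : R) : R := Num.min (Num.max s a) b.

Lemma clamp_le (R : realType) (a b s : R) : a <= b -> s <= a -> clamp a b s = a.
Proof. by move=> ab sa; rewrite /clamp (max_idPr sa) (min_idPl ab). Qed.

Lemma clamp_ge (R : realType) (a b s : R) : a <= b -> b <= s -> clamp a b s = b.
Proof.
move=> ab bs; rewrite /clamp (max_idPl _) ?(le_trans ab)//.
exact/min_idPr.
Qed.

Lemma clamp_in (R : realType) (a b s : R) : a <= s -> s <= b -> clamp a b s = s.
Proof. by move=> sa sb; rewrite /clamp (max_idPl sa) (min_idPl sb). Qed.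

Lemma continuous_clamp (R : realType) (a b : R) : continuous (clamp a b).
Proof.
move=> s; apply: (@continuous_min _ _ (fun s => Num.max s a) (fun=> b)).
  by apply: (@continuous_max _ _ id (fun=> a)); [exact: cvg_id|exact: cvg_cst].
exact: cvg_cst.
Qed.

Lemma is_derive_comp_clamp_in (R : realType) (a b : R) (F : R -> R) s d :
  a < s -> s < b ->
  is_derive s 1 F d -> is_derive s 1 (F \o clamp a b) d.
Proof.
move=> sa sb; apply: near_eq_is_derive; near=> r.
rewrite /= clamp_in//; near: r; last exact: lt_le_nbhsl.
by apply: filterS (lt_nbhsr sa) => ? /ltW.
Unshelve. all: by end_near. Qed.

Lemma is_derive_comp_clamp_out (R : realType) (a b : R) (F : R -> R) s :
  a <= b -> s < a \/ b < s ->
  is_derive s 1 (F \o clamp a b) 0.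
Proof.
move=> ab [sa|bs].
  apply: (@near_eq_is_derive _ _ _ (cst (F a))); near=> r.
  by rewrite /= clamp_le//; near: r; exact: lt_le_nbhsl.
apply: (@near_eq_is_derive _ _ _ (cst (F b))); near=> r.
by rewrite /= clamp_ge//; near: r; apply: filterS (lt_nbhsr bs) => ? /ltW.
Unshelve. all: by end_near. Qed.

(** * Iterated integrals of the switching pattern *)

(** The integral over [[0, s]] of the indicator of the [i]-th switching
    interval. *)
Definition elapsed (R : realType) (t : nat -> R) (i : nat) (s : R) : R :=
  clamp (t i) (t i.+1) s - t i.

(** The primitive of [elapsed t i ^+ k] that vanishes at [0].  The first term
    accounts for the time until [t i.+1]; from then on the elapsed time keeps the
    value [duration t i], which the second term integrates. *)
Definition elapsed_pow_primitive (R : realType) (t : nat -> R) (k i : nat)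
    (s : R) : R :=
  k.+1%:R^-1 * elapsed t i s ^+ k.+1
  + duration t i ^+ k * (Num.max s (t i.+1) - t i.+1).

(** The primitive of [Vcoef t i j] that vanishes at [0]. *)
Definition Vprimitive (R : realType) (t : nat -> R) (i j : nat) (s : R) : R :=
  if (i < j)%N then 0
  else if i == j then 2^-1 * elapsed_pow_primitive t 2 i s
  else duration t j * elapsed_pow_primitive t 1 i s.

(** The integral over [[0, s]] of [Vcoef t i j] times the indicator of the [l]-th
    switching interval: clamping the argument freezes the primitive outside that
    interval. *)
Definition Vgated (R : realType) (t : nat -> R) (i j l : nat) (s : R) : R :=
  Vprimitive t i j (clamp (t l) (t l.+1) s) - Vprimitive t i j (t l).

Definition increasing_upto (R : realType) (N : nat) (t : nat -> R) : Prop :=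
  forall j, (j < N)%N -> t j < t j.+1.

Lemma increasing_upto_le (R : realType) (N : nat) (t : nat -> R) (i l : nat) :
  increasing_upto N t -> (i <= l)%N -> (l <= N)%N -> t i <= t l.
Proof.
move=> inc; elim: l => [|l IH]; first by rewrite leqn0 => /eqP ->.
rewrite leq_eqVlt => /predU1P[-> //|il lN].
by rewrite (le_trans (IH il (ltnW lN)))// ltW// inc.
Qed.

(** All three branches of [Vcoef] are polynomials in the time elapsed, which
    removes the case distinction on the position of [s]. *)
Lemma VcoefE (R : realType) (t : nat -> R) (i j : nat) (s : R) :
  t i < t i.+1 ->
  Vcoef t i j s = if (i < j)%N then 0
    else if i == j then 2^-1 * elapsed t i s ^+ 2
    else duration t j * elapsed t i s.
Proof.
move=> ti; rewrite /Vcoef /elapsed /duration; case: ifP => // _.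
case: (leP s (t i)) => [si|si].
  by rewrite clamp_le ?(ltW ti)// subrr expr0n !mulr0; case: ifP.
case: (ltP s (t i.+1)) => [si1|si1].
  by rewrite clamp_in// ?ltW//; case: ifP => // _; rewrite mulrC.
by rewrite clamp_ge// ?ltW//; case: ifP => // _; rewrite mulrC.
Qed.

Lemma elapsedE (R : realType) (N : nat) (t : nat -> R) (i l : nat) (s : R) :
  increasing_upto N t -> (i < N)%N -> (l < N)%N -> t l <= s -> s <= t l.+1 ->
  elapsed t i s = if (i < l)%N then duration t i
                  else if i == l then s - t l else 0.
Proof.
move=> inc iN lN ls sl; rewrite /elapsed /duration.
have ti : t i <= t i.+1 by rewrite ltW// inc.
have [il|li|il] := ltngtP i l; last by rewrite -il in ls sl *; rewrite clamp_in.
  by rewrite clamp_ge// (le_trans _ ls)// (increasing_upto_le inc)// ltnW.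
by rewrite clamp_le ?subrr// (le_trans sl)// (increasing_upto_le inc)// ltnW.
Qed.

Lemma is_derive_elapsed (R : realType) (N : nat) (t : nat -> R) (i l : nat)
    (s : R) :
  increasing_upto N t -> (i < N)%N -> (l < N)%N -> t l < s -> s < t l.+1 ->
  is_derive s 1 (elapsed t i) (i == l)%:R.
Proof.
move=> inc iN lN ls sl.
have E : elapsed t i = (id - cst (t i)) \o clamp (t i) (t i.+1) by [].
have d1 : is_derive s 1 (id - cst (t i) : R -> R) 1.
  by apply: is_derive_eq; rewrite subr0.
rewrite E; have [il|li|il] := ltngtP i l.
- apply: is_derive_comp_clamp_out; first by rewrite ltW// inc.
  by right; rewrite (le_lt_trans _ ls)// (increasing_upto_le inc)// ltnW.
- apply: is_derive_comp_clamp_out; first by rewrite ltW// inc.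
  by left; rewrite (lt_le_trans sl)// (increasing_upto_le inc)// ltnW.
- by rewrite -il in ls sl *; exact: is_derive_comp_clamp_in.
Qed.

Lemma is_derive_excess (R : realType) (N : nat) (t : nat -> R) (i l : nat)
    (s : R) :
  increasing_upto N t -> (i < N)%N -> (l < N)%N -> t l < s -> s < t l.+1 ->
  is_derive s 1 (fun r => Num.max r (t i.+1) - t i.+1) (i < l)%:R.
Proof.
move=> inc iN lN ls sl; have [il|li] := ltnP i l.
  apply: (@near_eq_is_derive _ _ _ (id - cst (t i.+1))); last first.
    by apply: is_derive_eq; rewrite subr0.
  have ils : t i.+1 < s.
    by rewrite (le_lt_trans _ ls)// (increasing_upto_le inc)// ltnW.
  near=> r; rewrite !fctE (max_idPl _)//.
  by near: r; apply: filterS (lt_nbhsr ils) => ? /ltW.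
apply: (@near_eq_is_derive _ _ _ (cst (0 : R))).
have ils : s < t i.+1.
  by rewrite (lt_le_trans sl)// (increasing_upto_le inc)// ltnW.
near=> r; rewrite /cst (max_idPr _) ?subrr//.
by near: r; exact: lt_le_nbhsl.
Unshelve. all: by end_near. Qed.

(** Before the [i]-th interval the derivative is [0 = elapsed t i s ^+ k], which
    is where [0 < k] enters. *)
Lemma is_derive_elapsed_pow_primitive (R : realType) (N : nat) (t : nat -> R)
    (k i l : nat) (s : R) : (0 < k)%N ->
  increasing_upto N t -> (i < N)%N -> (l < N)%N -> t l < s -> s < t l.+1 ->
  is_derive s 1 (elapsed_pow_primitive t k i) (elapsed t i s ^+ k).
Proof.
move=> k0 inc iN lN ls sl.
have dW := is_derive_elapsed inc iN lN ls sl.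
have dm := is_derive_excess inc iN lN ls sl.
have -> : elapsed_pow_primitive t k i =
    k.+1%:R^-1 \*: (elapsed t i ^+ k.+1)
    + (duration t i ^+ k) \*: (fun r => Num.max r (t i.+1) - t i.+1).
  by apply/funext => r; rewrite !fctE.
apply: is_derive_eq; rewrite /= !scalerA.
rewrite (elapsedE inc iN lN (ltW ls) (ltW sl)) mulrA mulVf ?pnatr_eq0// mul1r.
rewrite /GRing.scale/=.
have [il|li|il] := ltngtP i l; rewrite ?(mulr1, mulr0, addr0, add0r)//.
by rewrite expr0n -(prednK k0).
Qed.

(** On the [i]-th interval, [elapsed t j] is already constant if [j < i] and still
    zero if [i < j]; so the formulas that define [Vcoef] do satisfy the equation
    of an iterated integral. *)
Lemma is_derive_Vcoef (R : realType) (N : nat) (t : nat -> R) (i j l : nat)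
    (s : R) :
  increasing_upto N t -> (i < N)%N -> (j < N)%N -> (l < N)%N ->
  t l < s -> s < t l.+1 ->
  is_derive s 1 (Vcoef t i j) ((i == l)%:R * elapsed t j s).
Proof.
move=> inc iN jN lN ls sl; have dW := is_derive_elapsed inc iN lN ls sl.
have -> : Vcoef t i j = fun r => if (i < j)%N then 0
    else if i == j then 2^-1 * elapsed t i r ^+ 2
    else duration t j * elapsed t i r.
  by apply/funext => r; rewrite VcoefE// inc.
have := elapsedE inc jN lN (ltW ls) (ltW sl).
have [ij|ji|<-] := ltngtP i j => Wj.
- rewrite (_ : _ * _ = 0); first exact: is_derive_cst.
  have [il|] := eqVneq i l; last by rewrite mul0r.
  by rewrite Wj -il ltnNge (ltnW ij)/= gtn_eqF// mulr0.
- have -> : (fun r => duration t j * elapsed t i r) = duration t j \*: elapsed t i.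
    by [].
  apply: is_derive_eq; rewrite /GRing.scale/= mulrC.
  by have [il|] := eqVneq i l; rewrite ?mul0r// Wj -il ji.
- have -> : (fun r => 2^-1 * elapsed t i r ^+ 2) = 2^-1 \*: (elapsed t i ^+ 2).
    by apply/funext => r; rewrite !fctE.
  apply: is_derive_eq; rewrite /GRing.scale/= mulrA mulrA mulVf ?pnatr_eq0//.
  by rewrite mul1r mulrC.
Qed.

Lemma is_derive_Vprimitive (R : realType) (N : nat) (t : nat -> R)
    (i j l : nat) (s : R) :
  increasing_upto N t -> (i < N)%N -> (l < N)%N -> t l < s -> s < t l.+1 ->
  is_derive s 1 (Vprimitive t i j) (Vcoef t i j s).
Proof.
move=> inc iN lN ls sl; rewrite VcoefE ?inc// /Vprimitive.
have dp k k0 := @is_derive_elapsed_pow_primitive _ _ _ k _ _ _ k0 inc iN lN ls sl.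
have [ij|ji|ij] := ltngtP i j; first exact: is_derive_cst.
  exact: (@is_deriveZ _ _ _ _ (duration t j) _ _ _ (dp 1%N isT)).
exact: (@is_deriveZ _ _ _ _ 2^-1 _ _ _ (dp 2%N isT)).
Qed.

Lemma is_derive_Vgated (R : realType) (N : nat) (t : nat -> R)
    (i j k l : nat) (s : R) :
  increasing_upto N t -> (i < N)%N -> (k < N)%N -> (l < N)%N ->
  t l < s -> s < t l.+1 ->
  is_derive s 1 (Vgated t i j k) ((k == l)%:R * Vcoef t i j s).
Proof.
move=> inc iN kN lN ls sl.
have -> : Vgated t i j k =
    (Vprimitive t i j \o clamp (t k) (t k.+1)) - cst (Vprimitive t i j (t k)).
  by [].
suff d : is_derive s 1 (Vprimitive t i j \o clamp (t k) (t k.+1))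
    ((k == l)%:R * Vcoef t i j s) by apply: is_derive_eq; rewrite subr0.
have [kl|lk|kl] := ltngtP k l; rewrite ?mul0r ?mul1r.
- apply: is_derive_comp_clamp_out; first by rewrite ltW// inc.
  by right; rewrite (le_lt_trans _ ls)// (increasing_upto_le inc)// ltnW.
- apply: is_derive_comp_clamp_out; first by rewrite ltW// inc.
  by left; rewrite (lt_le_trans sl)// (increasing_upto_le inc)// ltnW.
- rewrite kl; apply: is_derive_comp_clamp_in => //.
  exact: is_derive_Vprimitive inc iN lN ls sl.
Qed.

Lemma continuous_elapsed (R : realType) (t : nat -> R) i :
  continuous (elapsed t i).
Proof. by move=> s; apply: cvgB; [exact: continuous_clamp|exact: cvg_cst]. Qed.

Lemma continuous_elapsed_pow (R : realType) (t : nat -> R) k i :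
  continuous (fun s => elapsed t i s ^+ k).
Proof.
move=> s; apply: (@continuous_comp _ _ _ (elapsed t i) (fun y : R => y ^+ k)).
  exact: continuous_elapsed.
exact: exprn_continuous.
Qed.

Lemma continuous_elapsed_pow_primitive (R : realType) (t : nat -> R) k i :
  continuous (elapsed_pow_primitive t k i).
Proof.
move=> s; apply: cvgD; apply: cvgM; try exact: cvg_cst.
  exact: continuous_elapsed_pow.
apply: cvgB; last exact: cvg_cst.
by apply: (@continuous_max _ _ id (fun=> t i.+1)); [exact: cvg_id|exact: cvg_cst].
Qed.

Lemma continuous_Vprimitive (R : realType) (t : nat -> R) i j :
  continuous (Vprimitive t i j).
Proof.
suff : continuous (fun s => if (i < j)%N then 0
    else if i == j then 2^-1 * elapsed_pow_primitive t 2 i s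
    else duration t j * elapsed_pow_primitive t 1 i s) by [].
have [ij|ji|ij] := ltngtP i j; first exact: cst_continuous.
  by move=> s; apply: cvgM; [exact: cvg_cst|exact: continuous_elapsed_pow_primitive].
by move=> s; apply: cvgM; [exact: cvg_cst|exact: continuous_elapsed_pow_primitive].
Qed.

Lemma continuous_Vcoef (R : realType) (t : nat -> R) i j : t i < t i.+1 ->
  continuous (Vcoef t i j).
Proof.
move=> ti; have -> : Vcoef t i j = fun r => if (i < j)%N then 0
    else if i == j then 2^-1 * elapsed t i r ^+ 2
    else duration t j * elapsed t i r.
  by apply/funext => r; rewrite VcoefE.
have [ij|ji|ij] := ltngtP i j; first exact: cst_continuous.
  by move=> s; apply: cvgM; [exact: cvg_cst|exact: continuous_elapsed].
by move=> s; apply: cvgM; [exact: cvg_cst|exact: continuous_elapsed_pow].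
Qed.

Lemma continuous_Vgated (R : realType) (t : nat -> R) i j l :
  continuous (Vgated t i j l).
Proof.
move=> s; apply: cvgB; last exact: cvg_cst.
apply: (@continuous_comp _ _ _ (clamp (t l) (t l.+1)) (Vprimitive t i j)).
  exact: continuous_clamp.
exact: continuous_Vprimitive.
Qed.

Lemma elapsed0 (R : realType) (N : nat) (t : nat -> R) i :
  t 0%N = 0 -> increasing_upto N t -> (i < N)%N -> elapsed t i 0 = 0.
Proof.
move=> t0 inc iN; have N0 : (0 < N)%N by exact: leq_ltn_trans iN.
rewrite (elapsedE inc iN N0) ?t0 ?subrr//; first by case: i iN.
by rewrite -t0 ltW// inc.
Qed.

Lemma elapsed_end (R : realType) (N : nat) (t : nat -> R) i :
  increasing_upto N t -> (i < N)%N -> elapsed t i (t N) = duration t i.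
Proof.
move=> inc iN; rewrite /elapsed clamp_ge//; first by rewrite ltW// inc.
exact: increasing_upto_le inc _ _.
Qed.

Lemma elapsed_pow_primitive0 (R : realType) (N : nat) (t : nat -> R) k i :
  t 0%N = 0 -> increasing_upto N t -> (i < N)%N ->
  elapsed_pow_primitive t k i 0 = 0.
Proof.
move=> t0 inc iN; rewrite /elapsed_pow_primitive (elapsed0 t0 inc iN).
rewrite expr0n mulr0 add0r (max_idPr _) ?subrr ?mulr0//.
by rewrite -t0 (increasing_upto_le inc).
Qed.

Lemma elapsed_pow_primitive_end (R : realType) (N : nat) (t : nat -> R) k i :
  increasing_upto N t -> (i < N)%N ->
  elapsed_pow_primitive t k i (t N) =
  k.+1%:R^-1 * duration t i ^+ k.+1 + duration t i ^+ k * (t N - t i.+1).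
Proof.
move=> inc iN; rewrite /elapsed_pow_primitive (elapsed_end inc iN).
by rewrite (max_idPl _)// (increasing_upto_le inc).
Qed.

Lemma Vprimitive0 (R : realType) (N : nat) (t : nat -> R) i j :
  t 0%N = 0 -> increasing_upto N t -> (i < N)%N -> Vprimitive t i j 0 = 0.
Proof.
move=> t0 inc iN; rewrite /Vprimitive !(elapsed_pow_primitive0 _ t0 inc iN).
by rewrite !mulr0 !if_same.
Qed.

Lemma Vcoef0 (R : realType) (N : nat) (t : nat -> R) i j :
  t 0%N = 0 -> increasing_upto N t -> (i < N)%N -> Vcoef t i j 0 = 0.
Proof.
move=> t0 inc iN; rewrite VcoefE ?inc// (elapsed0 t0 inc iN) expr0n.
by rewrite !mulr0 !if_same.
Qed.

Lemma Vcoef_end (R : realType) (N : nat) (t : nat -> R) i j :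
  increasing_upto N t -> (i < N)%N ->
  Vcoef t i j (t N) = if (i < j)%N then 0
    else if i == j then duration t i ^+ 2 / 2 else duration t i * duration t j.
Proof.
move=> inc iN; rewrite VcoefE ?inc// (elapsed_end inc iN).
by rewrite mulrC [duration t j * _]mulrC.
Qed.

Lemma Vgated0 (R : realType) (N : nat) (t : nat -> R) i j l :
  t 0%N = 0 -> increasing_upto N t -> (l < N)%N -> Vgated t i j l 0 = 0.
Proof.
move=> t0 inc lN; rewrite /Vgated clamp_le ?subrr//; first by rewrite ltW// inc.
by rewrite -t0 (increasing_upto_le inc)// ltnW.
Qed.

Lemma Rintegral_FTC2 (R : realType) (q F : R -> R) (a b : R) : a < b ->
  continuous q -> continuous F ->
  (forall s, a < s -> s < b -> is_derive s 1 F (q s)) ->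
  \int[lebesgue_measure]_(s in `[a, b]) q s = F b - F a.
Proof.
move=> ab cq cF dF; rewrite /Rintegral (@continuous_FTC2 _ q F)//.
- exact: continuous_subspaceT.
- split; [move=> s|exact/cvg_at_right_filter/cF|exact/cvg_at_left_filter/cF].
  by rewrite in_itv/= => /andP[sa sb]; have [] := dF s sa sb.
- move=> s; rewrite in_itv/= => /andP[sa sb].
  by rewrite derive1E; have [] := dF s sa sb.
Qed.

Lemma Vgated_end (R : realType) (N : nat) (t : nat -> R) i j l :
  increasing_upto N t -> (i < N)%N -> (l < N)%N ->
  Vgated t i j l (t N) =
  \int[lebesgue_measure]_(s in `[t l, t l.+1]) Vcoef t i j s.
Proof.
move=> inc iN lN; rewrite /Vgated clamp_ge; last 2 first.
- by rewrite ltW// inc.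
- exact: increasing_upto_le inc _ _.
apply/esym/Rintegral_FTC2; first exact: inc.
- by apply: continuous_Vcoef; exact: inc.
- exact: continuous_Vprimitive.
- by move=> s ls sl; exact: is_derive_Vprimitive inc iN lN ls sl.
Qed.

(** * Gaining one order along a trajectory *)

Lemma itv_between_nodes (R : realType) (n : nat) (t : nat -> R) (s : R) :
  t 0%N < s -> s < t n -> (forall j, (j <= n)%N -> s != t j) ->
  exists2 l, (l < n)%N & t l < s /\ s < t l.+1.
Proof.
move=> t0s; elim: n => [|n IH] stn sE.
  by move: (lt_trans t0s stn); rewrite ltxx.
have [sn|ns] := ltP s (t n).
  have [|l ln ?] := IH sn; first by move=> j jn; rewrite sE// leqW.
  by exists l => //; rewrite leqW.
by exists n => //; rewrite lt_neqAle eq_sym sE.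
Qed.

Lemma switching_interval (R : realType) (N : nat) (t : nat -> R) (tau s : R) :
  switching_times N tau t -> 0 < s -> s < tau ->
  s \notin [seq t j | j <- iota 0 N.+1] ->
  exists l : 'I_N, t l < s /\ s < t l.+1.
Proof.
move=> [t0 _ tN] s0 stau sT; rewrite -t0 in s0; rewrite -tN in stau.
have [j jN|l lN lsl] := itv_between_nodes s0 stau.
  apply: contraNneq sT => ->.
  by apply: (@map_f _ _ t (iota 0 N.+1)); rewrite mem_iota.
by exists (Ordinal lN).
Qed.

(** The form of [is_solution] that the expansions use: the control has
    disappeared, and on the [l]-th interval the velocity is given by [f l]. *)
Definition switched_trajectory (R : realType) (n N : nat)
    (X : set 'rV[R]_n.+1) (f : 'I_N -> 'rV[R]_n.+1 -> 'rV[R]_n.+1)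
    (t : nat -> R) (tau : R) (x : R -> 'rV[R]_n.+1) : Prop :=
  [/\ switching_times N tau t,
      {within `[0, tau], continuous x},
      forall s, s \in `[0, tau] -> X (x s) &
      exists E : seq R, forall (l : 'I_N) s, t l < s -> s < t l.+1 ->
        s \notin E -> is_derive s 1 x (f l (x s))].

Lemma is_solution_switched (R : realType) (n m N : nat) (X : set 'rV[R]_n.+1)
    (f0 : 'rV[R]_n.+1 -> 'rV[R]_n.+1) (g : 'I_m -> 'rV[R]_n.+1 -> 'rV[R]_n.+1)
    (v : 'I_N -> 'rV[R]_m) (t : nat -> R) (tau : R) (x : R -> 'rV[R]_n.+1) :
  switching_times N tau t ->
  is_solution X f0 g (pw_constant t v) tau x ->
  switched_trajectory X (fun l => affine_field f0 g (v l)) t tau x.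
Proof.
move=> st [xc xX [E dx]]; split=> //; exists E => l s ls sl sE.
have [t0 inc tN] := st.
have -> : v l = pw_constant t v s.
  rewrite /pw_constant (bigD1 l)//= (ltW ls) sl/= big1 ?addr0// => i il.
  case: ifP => // /andP[is_ si]; move: il; rewrite -(inj_eq val_inj) neq_ltn.
  case/orP => il.
    have := increasing_upto_le inc il (ltnW (ltn_ord l)).
    by rewrite leNgt (lt_trans ls si).
  have := increasing_upto_le inc il (ltnW (ltn_ord i)).
  by rewrite leNgt (le_lt_trans is_ sl).
apply: dx => //; rewrite in_itv/=.
have := increasing_upto_le inc (leq0n l) (ltnW (ltn_ord l)).
have := increasing_upto_le inc (ltn_ord l) (leqnn N).
by rewrite t0 tN => sN l0; rewrite (le_lt_trans l0 ls) (lt_le_trans sl sN).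
Qed.

Lemma is_derive_along (R : realType) (n p : nat)
    (h : 'rV[R]_n.+1 -> 'rV[R]_p.+1) (k : 'I_p.+1) (x : R -> 'rV[R]_n.+1) s v :
  differentiable h (x s) -> is_derive s 1 x v ->
  is_derive s 1 (fun r => h (x r) 0 k) ('d h (x s) v 0 k).
Proof.
move=> dh [dx <-]; have dx' := (derivable1_diffP x s).1 dx.
have dhx : differentiable (h \o x) s by exact: differentiable_comp.
have [dk Dk] := derive_coord k dhx.
apply: DeriveDef; first exact: diff_derivable.
by rewrite Dk deriveE// diff_comp//= deriveE.
Qed.

Lemma within_continuous_coord (R : realType) (n p : nat) (X : set 'rV[R]_n.+1)
    (h : 'rV[R]_n.+1 -> 'rV[R]_p.+1) (k : 'I_p.+1) (x : R -> 'rV[R]_n.+1) a b :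
  (forall y, X y -> differentiable h y) ->
  {within `[a, b], continuous x} -> (forall s, s \in `[a, b] -> X (x s)) ->
  {within `[a, b], continuous (fun r => h (x r) 0 k)}.
Proof.
move=> dh xc xX.
apply: (@within_continuous_comp _ _ _ _ x (fun y => h y 0 k)) => // y.
rewrite inE => -[s /= sab <-]; apply: differentiable_continuous.
by apply: (derive_coord k _).1; apply: dh; exact: xX.
Qed.

Lemma sum_pick (R : realType) (N : nat) (l : 'I_N) (a : 'I_N -> R) :
  \sum_(i < N) (i == l :> nat)%:R * a i = a l.
Proof.
rewrite (bigD1 l)//= eqxx mul1r big1 ?addr0// => i il.
by rewrite (inj_eq val_inj) (negbTE il) mul0r.
Qed.

(** If [P l] approximates [L_l h] along the trajectory to order [q] for each [l],
    then a primitive [Q] of the function equal to [P l] on the [l]-th interval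
    approximates [h] to order [q.+1]: by the chain rule the derivative of [h]
    along the trajectory is [L_l h] on that interval. *)
Lemma Lie_expansion_step (R : realType) (n p N q : nat) (X : set 'rV[R]_n.+1)
    (f : 'I_N -> 'rV[R]_n.+1 -> 'rV[R]_n.+1) (t : nat -> R) (tau : R)
    (x : R -> 'rV[R]_n.+1) (h : 'rV[R]_n.+1 -> 'rV[R]_p.+1) (k : 'I_p.+1)
    (C : R) (P : 'I_N -> R -> R) (Q : R -> R) :
  switched_trajectory X f t tau x -> 0 <= C ->
  (forall y, X y -> differentiable h y) ->
  continuous Q -> Q 0 = h (x 0) 0 k ->
  (forall (l : 'I_N) s, t l < s -> s < t l.+1 -> is_derive s 1 Q (P l s)) ->
  (forall (l : 'I_N) s, s \in `[0, tau] ->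
     `|Lie (f l) h (x s) 0 k - P l s| <= C * s ^+ q) ->
  forall s, s \in `[0, tau] -> `|h (x s) 0 k - Q s| <= C * s ^+ q.+1.
Proof.
move=> [st xc xX [E dx]] C0 dh Qc Q0 dQ b.
apply: (@primitive_comparison _ _ _ _ _ _ (E ++ [seq t j | j <- iota 0 N.+1])) => //.
- exact: within_continuous_coord dh xc xX.
- exact: continuous_subspaceT.
move=> s; rewrite in_itv/= mem_cat negb_or => /andP[s0 stau] /andP[sE sT].
have [l [ls sl]] := switching_interval st s0 stau sT.
have sI : s \in `[0, tau] by rewrite in_itv/= !ltW.
have dhs := dh _ (xX _ sI).
exists (Lie (f l) h (x s) 0 k), (P l s); split.
- by rewrite LieE//; apply: is_derive_along => //; exact: (dx l).
- exact: dQ.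
- exact: b.
Qed.

(** * Expansions of observables up to fourth order *)

Lemma is_derive_lincomb (R : realType) (I : finType) (F : I -> R -> R)
    (dF c : I -> R) (s : R) :
  (forall i, is_derive s 1 (F i) (dF i)) ->
  is_derive s 1 (fun r => \sum_i F i r * c i) (\sum_i dF i * c i).
Proof.
move=> dFi.
have -> : (fun r => \sum_i F i r * c i) = \sum_i (c i \*: F i).
  apply/funext => r; rewrite fct_sumE; apply: eq_bigr => i _.
  exact: mulrC.
elim/big_ind2 : _ => [|f1 d1 f2 d2 ? ?|i _]; first exact: is_derive_cst.
  exact: is_deriveD.
by rewrite mulrC; exact: is_deriveZ.
Qed.

Lemma continuous_fsum (R : realType) (I : finType) (F : I -> R -> R) :
  (forall i, continuous (F i)) -> continuous (fun r => \sum_i F i r).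
Proof.
by move=> cF; apply: continuous_big => //; exact: add_continuous.
Qed.

Lemma continuous_lincomb (R : realType) (I : finType) (F : I -> R -> R)
    (c : I -> R) :
  (forall i, continuous (F i)) -> continuous (fun r => \sum_i F i r * c i).
Proof.
move=> cF; apply: continuous_fsum => i r.
by apply: cvgM; [exact: cF|exact: cvg_cst].
Qed.

(** Each of the four expansions below is one application of the step to the
    preceding expansion of the functions [L_l h]; this one starts from the
    approximation of [L_l h] by zero. *)
Lemma Lie_expansion1 (R : realType) (n p N : nat) (X : set 'rV[R]_n.+1)
    (f : 'I_N -> 'rV[R]_n.+1 -> 'rV[R]_n.+1) (t : nat -> R) (tau : R)
    (x : R -> 'rV[R]_n.+1) (h : 'rV[R]_n.+1 -> 'rV[R]_p.+1) (k : 'I_p.+1)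
    (C : R) :
  switched_trajectory X f t tau x -> 0 <= C -> smooth_on X h ->
  (forall l s, s \in `[0, tau] -> `|Lie (f l) h (x s) 0 k| <= C) ->
  forall s, s \in `[0, tau] -> `|h (x s) 0 k - h (x 0) 0 k| <= C * s.
Proof.
move=> tr C0 sh b s sI; rewrite -[s in C * s]expr1.
apply: (@Lie_expansion_step _ _ _ _ 0 _ _ _ _ _ _ _ _ (fun _ _ => 0)
  (fun=> h (x 0) 0 k) tr C0) => //.
- exact: smooth_on_differentiable.
- exact: cst_continuous.
- by move=> l r rI; rewrite subr0 expr0 mulr1; exact: b.
Qed.

Lemma Lie_expansion2 (R : realType) (n p N : nat) (X : set 'rV[R]_n.+1)
    (f : 'I_N -> 'rV[R]_n.+1 -> 'rV[R]_n.+1) (t : nat -> R) (tau : R)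
    (x : R -> 'rV[R]_n.+1) (h : 'rV[R]_n.+1 -> 'rV[R]_p.+1) (k : 'I_p.+1)
    (C : R) :
  open X -> (forall l, smooth_on X (f l)) ->
  switched_trajectory X f t tau x -> 0 <= C -> smooth_on X h ->
  (forall i l s, s \in `[0, tau] ->
     `|Lie (f i) (Lie (f l) h) (x s) 0 k| <= C) ->
  forall s, s \in `[0, tau] ->
  `|h (x s) 0 k - (h (x 0) 0 k
      + \sum_(i < N) elapsed t i s * Lie (f i) h (x 0) 0 k)| <= C * s ^+ 2.
Proof.
move=> oX sf tr C0 sh b; have [[t0 inc tN] _ _ _] := tr.
apply: (@Lie_expansion_step _ _ _ _ 1 _ _ _ _ _ _ _ _
  (fun l _ => Lie (f l) h (x 0) 0 k)
  (fun s => h (x 0) 0 k + \sum_(i < N) elapsed t i s * Lie (f i) h (x 0) 0 k)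
  tr C0).
- exact: smooth_on_differentiable.
- move=> s; apply: cvgD; first exact: cvg_cst.
  by apply: continuous_lincomb => i; exact: continuous_elapsed.
- by rewrite big1 ?addr0// => i _; rewrite (elapsed0 t0 inc)// mul0r.
- move=> l s ls sl.
  have d := is_derive_lincomb (fun i : 'I_N => Lie (f i) h (x 0) 0 k)
    (fun i : 'I_N => is_derive_elapsed inc (ltn_ord i) (ltn_ord l) ls sl).
  rewrite sum_pick in d.
  have dc := is_derive_cst (h (x 0) 0 k) s 1.
  by apply: is_derive_eq (is_deriveD dc d) _; rewrite add0r.
- move=> l s sI; rewrite expr1; apply: (Lie_expansion1 tr C0) => //.
    exact: smooth_on_Lie.
  by move=> *; exact: b.
Qed.

Lemma Lie_expansion3 (R : realType) (n p N : nat) (X : set 'rV[R]_n.+1)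
    (f : 'I_N -> 'rV[R]_n.+1 -> 'rV[R]_n.+1) (t : nat -> R) (tau : R)
    (x : R -> 'rV[R]_n.+1) (h : 'rV[R]_n.+1 -> 'rV[R]_p.+1) (k : 'I_p.+1)
    (C : R) :
  open X -> (forall l, smooth_on X (f l)) ->
  switched_trajectory X f t tau x -> 0 <= C -> smooth_on X h ->
  (forall j i l s, s \in `[0, tau] ->
     `|Lie (f j) (Lie (f i) (Lie (f l) h)) (x s) 0 k| <= C) ->
  forall s, s \in `[0, tau] ->
  `|h (x s) 0 k - (h (x 0) 0 k
      + \sum_(i < N) elapsed t i s * Lie (f i) h (x 0) 0 k
      + \sum_(i < N) \sum_(j < N)
          Vcoef t i j s * Lie (f j) (Lie (f i) h) (x 0) 0 k)| <= C * s ^+ 3.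
Proof.
move=> oX sf tr C0 sh b; have [[t0 inc tN] _ _ _] := tr.
apply: (@Lie_expansion_step _ _ _ _ 2 _ _ _ _ _ _ _ _
  (fun l s => Lie (f l) h (x 0) 0 k
     + \sum_(j < N) elapsed t j s * Lie (f j) (Lie (f l) h) (x 0) 0 k)
  (fun s => h (x 0) 0 k + \sum_(i < N) elapsed t i s * Lie (f i) h (x 0) 0 k
     + \sum_(i < N) \sum_(j < N)
          Vcoef t i j s * Lie (f j) (Lie (f i) h) (x 0) 0 k)
  tr C0).
- exact: smooth_on_differentiable.
- move=> s; apply: cvgD; first apply: cvgD; first exact: cvg_cst.
    by apply: continuous_lincomb => i; exact: continuous_elapsed.
  apply: continuous_fsum => i; apply: continuous_lincomb => j.
  by apply: continuous_Vcoef; exact: inc.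
- have W0 : \sum_(i < N) elapsed t i 0 * Lie (f i) h (x 0) 0 k = 0.
    by apply: big1 => i _; rewrite (elapsed0 t0 inc)// mul0r.
  have V0 : \sum_(i < N) \sum_(j < N)
      Vcoef t i j 0 * Lie (f j) (Lie (f i) h) (x 0) 0 k = 0.
    apply: big1 => i _; apply: big1 => j _.
    by rewrite (Vcoef0 _ t0 inc)// mul0r.
  by apply: etrans (congr2 +%R (congr1 (+%R _) W0) V0) _; rewrite !addr0.
- move=> l s ls sl.
  have d1 := is_derive_lincomb (fun i : 'I_N => Lie (f i) h (x 0) 0 k)
    (fun i : 'I_N => is_derive_elapsed inc (ltn_ord i) (ltn_ord l) ls sl).
  have d2 := is_derive_lincomb
    (fun ij : 'I_N * 'I_N => Lie (f ij.2) (Lie (f ij.1) h) (x 0) 0 k)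
    (fun ij : 'I_N * 'I_N => is_derive_Vcoef inc (ltn_ord ij.1) (ltn_ord ij.2)
       (ltn_ord l) ls sl).
  have -> : (fun r => h (x 0) 0 k
      + \sum_(i < N) elapsed t i r * Lie (f i) h (x 0) 0 k
      + \sum_(i < N) \sum_(j < N)
          Vcoef t i j r * Lie (f j) (Lie (f i) h) (x 0) 0 k) =
      cst (h (x 0) 0 k)
      + (fun r => \sum_(i < N) elapsed t i r * Lie (f i) h (x 0) 0 k)
      + (fun r => \sum_(ij : 'I_N * 'I_N) Vcoef t ij.1 ij.2 r
          * Lie (f ij.2) (Lie (f ij.1) h) (x 0) 0 k).
    by apply/funext => r; rewrite !fctE /= pair_bigA.
  rewrite sum_pick in d1; have dc := is_derive_cst (h (x 0) 0 k) s 1.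
  apply: is_derive_eq (is_deriveD (is_deriveD dc d1) d2) _.
  rewrite add0r; apply: congr1.
  rewrite -(pair_bigA _ (fun i j : 'I_N => (i == l :> nat)%:R * elapsed t j s
    * Lie (f j) (Lie (f i) h) (x 0) 0 k))/=.
  under eq_bigr do under eq_bigr do rewrite -mulrA.
  by under eq_bigr do rewrite -mulr_sumr; rewrite sum_pick.
- move=> l s sI; apply: (Lie_expansion2 oX sf tr C0) => //.
    exact: smooth_on_Lie.
  by move=> *; exact: b.
Qed.

Lemma Lie_expansion4 (R : realType) (n p N : nat) (X : set 'rV[R]_n.+1)
    (f : 'I_N -> 'rV[R]_n.+1 -> 'rV[R]_n.+1) (t : nat -> R) (tau : R)
    (x : R -> 'rV[R]_n.+1) (h : 'rV[R]_n.+1 -> 'rV[R]_p.+1) (k : 'I_p.+1)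
    (C : R) :
  open X -> (forall l, smooth_on X (f l)) ->
  switched_trajectory X f t tau x -> 0 <= C -> smooth_on X h ->
  (forall q j i l s, s \in `[0, tau] ->
     `|Lie (f q) (Lie (f j) (Lie (f i) (Lie (f l) h))) (x s) 0 k| <= C) ->
  forall s, s \in `[0, tau] ->
  `|h (x s) 0 k - (h (x 0) 0 k
      + \sum_(i < N) elapsed t i s * Lie (f i) h (x 0) 0 k
      + \sum_(i < N) \sum_(j < N)
          Vcoef t i j s * Lie (f j) (Lie (f i) h) (x 0) 0 k
      + \sum_(i < N) \sum_(j < N) \sum_(l < N)
          Vgated t i j l s * Lie (f j) (Lie (f i) (Lie (f l) h)) (x 0) 0 k)|
  <= C * s ^+ 4.
Proof.
move=> oX sf tr C0 sh b; have [[t0 inc tN] _ _ _] := tr.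
apply: (@Lie_expansion_step _ _ _ _ 3 _ _ _ _ _ _ _ _
  (fun l s => Lie (f l) h (x 0) 0 k
     + \sum_(j < N) elapsed t j s * Lie (f j) (Lie (f l) h) (x 0) 0 k
     + \sum_(i < N) \sum_(j < N)
          Vcoef t i j s * Lie (f j) (Lie (f i) (Lie (f l) h)) (x 0) 0 k)
  (fun s => h (x 0) 0 k + \sum_(i < N) elapsed t i s * Lie (f i) h (x 0) 0 k
     + \sum_(i < N) \sum_(j < N)
          Vcoef t i j s * Lie (f j) (Lie (f i) h) (x 0) 0 k
      + \sum_(i < N) \sum_(j < N) \sum_(l < N)
          Vgated t i j l s * Lie (f j) (Lie (f i) (Lie (f l) h)) (x 0) 0 k)
  tr C0).
- exact: smooth_on_differentiable.
- move=> s; do 3?[apply: cvgD]; first exact: cvg_cst.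
  + by apply: continuous_lincomb => i; exact: continuous_elapsed.
  + apply: continuous_fsum => i; apply: continuous_lincomb => j.
    by apply: continuous_Vcoef; exact: inc.
  + apply: continuous_fsum => i; apply: continuous_fsum => j.
    apply: continuous_lincomb => l.
    exact: continuous_Vgated.
- have W0 : \sum_(i < N) elapsed t i 0 * Lie (f i) h (x 0) 0 k = 0.
    by apply: big1 => i _; rewrite (elapsed0 t0 inc)// mul0r.
  have V0 : \sum_(i < N) \sum_(j < N)
      Vcoef t i j 0 * Lie (f j) (Lie (f i) h) (x 0) 0 k = 0.
    apply: big1 => i _; apply: big1 => j _.
    by rewrite (Vcoef0 _ t0 inc)// mul0r.
  have T0 : \sum_(i < N) \sum_(j < N) \sum_(l < N)
      Vgated t i j l 0 * Lie (f j) (Lie (f i) (Lie (f l) h)) (x 0) 0 k = 0.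
    apply: big1 => i _; apply: big1 => j _; apply: big1 => l _.
    by rewrite (Vgated0 _ _ t0 inc)// mul0r.
  apply: etrans (congr2 +%R (congr2 +%R (congr1 (+%R _) W0) V0) T0) _.
  by rewrite !addr0.
- move=> q s qs sq.
  have d1 := is_derive_lincomb (fun i : 'I_N => Lie (f i) h (x 0) 0 k)
    (fun i : 'I_N => is_derive_elapsed inc (ltn_ord i) (ltn_ord q) qs sq).
  have d2 := is_derive_lincomb
    (fun ij : 'I_N * 'I_N => Lie (f ij.2) (Lie (f ij.1) h) (x 0) 0 k)
    (fun ij : 'I_N * 'I_N => is_derive_Vcoef inc (ltn_ord ij.1) (ltn_ord ij.2)
       (ltn_ord q) qs sq).
  have d3 := is_derive_lincomb
    (fun w : ('I_N * 'I_N) * 'I_N =>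
       Lie (f w.1.2) (Lie (f w.1.1) (Lie (f w.2) h)) (x 0) 0 k)
    (fun w : ('I_N * 'I_N) * 'I_N => is_derive_Vgated w.1.2 inc
       (ltn_ord w.1.1) (ltn_ord w.2) (ltn_ord q) qs sq).
  have -> : (fun r => h (x 0) 0 k
      + \sum_(i < N) elapsed t i r * Lie (f i) h (x 0) 0 k
      + \sum_(i < N) \sum_(j < N)
          Vcoef t i j r * Lie (f j) (Lie (f i) h) (x 0) 0 k
      + \sum_(i < N) \sum_(j < N) \sum_(l < N)
          Vgated t i j l r * Lie (f j) (Lie (f i) (Lie (f l) h)) (x 0) 0 k) =
      cst (h (x 0) 0 k)
      + (fun r => \sum_(i < N) elapsed t i r * Lie (f i) h (x 0) 0 k)
      + (fun r => \sum_(ij : 'I_N * 'I_N) Vcoef t ij.1 ij.2 r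
          * Lie (f ij.2) (Lie (f ij.1) h) (x 0) 0 k)
      + (fun r => \sum_(w : ('I_N * 'I_N) * 'I_N) Vgated t w.1.1 w.1.2 w.2 r
          * Lie (f w.1.2) (Lie (f w.1.1) (Lie (f w.2) h)) (x 0) 0 k).
    apply/funext => r; apply: congr2; first apply: congr2; first by [].
      exact: pair_bigA.
    apply: etrans (pair_bigA _ (fun i j : 'I_N => \sum_(l < N)
      Vgated t i j l r * Lie (f j) (Lie (f i) (Lie (f l) h)) (x 0) 0 k)) _.
    exact: pair_bigA.
  rewrite sum_pick in d1; have dc := is_derive_cst (h (x 0) 0 k) s 1.
  apply: is_derive_eq (is_deriveD (is_deriveD (is_deriveD dc d1) d2) d3) _.
  rewrite add0r; apply: congr2; first apply: congr1.
    rewrite -(pair_bigA _ (fun i j : 'I_N => (i == q :> nat)%:R * elapsed t j s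
      * Lie (f j) (Lie (f i) h) (x 0) 0 k))/=.
    under eq_bigr do under eq_bigr do rewrite -mulrA.
    by under eq_bigr do rewrite -mulr_sumr; rewrite sum_pick.
  rewrite -(pair_bigA _ (fun (ij : 'I_N * 'I_N) (l : 'I_N) =>
    (l == q :> nat)%:R * Vcoef t ij.1 ij.2 s
      * Lie (f ij.2) (Lie (f ij.1) (Lie (f l) h)) (x 0) 0 k))/=.
  apply/esym/(etrans (pair_bigA _ (fun i j : 'I_N => Vcoef t i j s
    * Lie (f j) (Lie (f i) (Lie (f q) h)) (x 0) 0 k)))/eq_bigr => ij _; apply/esym.
  by under eq_bigr do rewrite -mulrA; rewrite sum_pick.
- move=> l s sI; apply: (Lie_expansion3 oX sf tr C0) => //.
    exact: smooth_on_Lie.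
  by move=> *; exact: b.
Qed.

(** * Bounds that are uniform over short trajectories *)

Lemma norm_coord_le (R : realType) (n : nat) (y : 'rV[R]_n) k :
  `|y 0 k| <= `|y|.
Proof.
rewrite [leRHS]/Num.norm/= mx_normrE; apply/bigmax_geP; right => /=.
by exists (0, k).
Qed.

Lemma norm_rV_le (R : realType) (n : nat) (y : 'rV[R]_n) (c : R) : 0 <= c ->
  (forall k, `|y 0 k| <= c) -> `|y| <= c.
Proof.
move=> c0 yc; rewrite [leLHS]/Num.norm/= mx_normrE; apply/bigmax_leP; split=> //.
by move=> -[i k] _ /=; rewrite ord1.
Qed.

Lemma locally_bounded_family (R : realType) (n p : nat) (I : finType)
    (X : set 'rV[R]_n) (G : I -> 'rV[R]_n -> 'rV[R]_p) (x0 : 'rV[R]_n) :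
  X x0 -> (forall i, smooth_on X (G i)) ->
  exists2 C : R, 0 < C & \forall y \near x0, forall i, `|G i y| <= C.
Proof.
move=> Xx0 sG; exists (\sum_i (`|G i x0| + 1) + 1).
  by rewrite ltr_wpDl// sumr_ge0// => i _; rewrite addr_ge0.
apply: (@filter_forall _ _ _ (nbhs x0) _) => i; have cG := sG i 0%N _ Xx0.
suff GC : `|G i x0| < \sum_i (`|G i x0| + 1) + 1 by apply: cvgr_norm_le cG _ GC.
by rewrite (bigD1 i)//= -!addrA ltrDl ltr_pwDl// addr_ge0// sumr_ge0// => j _.
Qed.

(** At the first time when the distance to the starting point reaches [r], the
    speed has so far been at most [M], so that distance is at most [M * tau],
    which is less than [r]. *)
Lemma trajectory_confined (R : realType) (n N : nat) (X : set 'rV[R]_n.+1)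
    (f : 'I_N -> 'rV[R]_n.+1 -> 'rV[R]_n.+1) (t : nat -> R) (tau : R)
    (x : R -> 'rV[R]_n.+1) (M r : R) :
  switched_trajectory X f t tau x -> 0 <= M -> 0 < r -> M * tau < r ->
  (forall y, `|y - x 0| < r -> forall l, `|f l y| <= M) ->
  forall s, s \in `[0, tau] -> `|x s - x 0| < r.
Proof.
move=> [st xc xX [E dx]] M0 r0 Mr fM s1 s1I.
rewrite ltNge; apply/negP => s1r.
have rc : {within `[0, tau], continuous (fun s => `|x s - x 0|)}.
  by move=> s; apply: cvg_norm; apply: cvgB; [exact: xc|exact: cvg_cst].
(* [A] is compact, so the first time at which the distance is at least [r] is
   its minimum [c]. *)
pose A := `[0, tau] `&` [set s | r <= `|x s - x 0|].
have cA : compact A.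
  have cl := (continuous_closedP _).1 rc _ (@closed_ge R r).
  have [V cV VA] := (closed_subspaceP _ _).1 cl.
  rewrite (_ : A = `[0, tau]%classic `&` V); last by rewrite setIC VA setIC.
  by apply: compact_closedI => //; exact: segment_compact.
have A1 : A !=set0 by exists s1; split.
have [c] := @compact_EVT_min _ R id A A1 cA
  (@continuous_subspaceT _ _ _ _ (fun=> cvg_id)).
rewrite inE => -[/= cI cr] cmin.
move: (cI); rewrite in_itv/= => /andP[c0 ctau].
(* The max norm allows the scalar mean value inequality to be used on each
   coordinate. *)
have xk k : `|x c 0 k - x 0 0 k| <= M * (c - 0).
  apply: (@mean_value_inequality R (fun s => x s 0 k) M
    (E ++ [seq t j | j <- iota 0 N.+1])) => //.
    apply: (@continuous_subspaceW _ _ _ `[0, tau]%classic).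
      by move=> s /=; rewrite !in_itv/= => /andP[-> /le_trans]; exact.
    by apply: (@within_continuous_coord _ _ _ setT id).
  move=> s; rewrite in_itv/= mem_cat negb_or => /andP[s0 sc] /andP[sE sT].
  have [l [ls sl]] := switching_interval st s0 (lt_le_trans sc ctau) sT.
  have sI : s \in `[0, tau] by rewrite in_itv/= (ltW s0) (ltW (lt_le_trans sc ctau)).
  have dxs := dx l s ls sl sE.
  exists (f l (x s) 0 k).
    have did : differentiable (@id 'rV[R]_n.+1) (x s) by exact: ex_diff.
    by have := is_derive_along k did dxs; rewrite diff_val.
  apply: le_trans (norm_coord_le _ _) _; apply: fM; rewrite ltNge; apply/negP => sr.
  by have := cmin s; rewrite inE leNgt sc => /(_ (conj sI sr)).
have : `|x c - x 0| <= M * c.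
  by apply: norm_rV_le; rewrite ?mulr_ge0// => k; rewrite !mxE -[c in M * c]subr0.
by rewrite leNgt (lt_le_trans _ cr)// (le_lt_trans _ Mr)// ler_wpM2l.
Qed.

(** The order of the quantifiers matters: [C] and [delta] are chosen before the
    switching times, the duration and the trajectory.  This is what turns the
    expansions into asymptotic relations as the duration tends to zero. *)
Lemma short_trajectory_bounds (R : realType) (n N : nat)
    (X : set 'rV[R]_n.+1) (f : 'I_N -> 'rV[R]_n.+1 -> 'rV[R]_n.+1)
    (x0 : 'rV[R]_n.+1) :
  open X -> X x0 -> (forall l, smooth_on X (f l)) ->
  exists2 C : R, 0 < C & exists2 delta : R, 0 < delta &
    forall t tau x, switched_trajectory X f t tau x -> x 0 = x0 ->
    0 < tau -> tau < delta -> forall s, s \in `[0, tau] ->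
    (forall j i l k, `|Lie (f j) (Lie (f i) (f l)) (x s) 0 k| <= C) /\
    (forall q j i l k,
       `|Lie (f q) (Lie (f j) (Lie (f i) (f l))) (x s) 0 k| <= C).
Proof.
move=> oX Xx0 sf.
have sL (h : 'rV[R]_n.+1 -> 'rV[R]_n.+1) l :
    smooth_on X h -> smooth_on X (Lie (f l) h) by exact: smooth_on_Lie.
have [M M0 fM] := locally_bounded_family Xx0 sf.
pose G3 (w : 'I_N * 'I_N * 'I_N) := Lie (f w.1.1) (Lie (f w.1.2) (f w.2)).
have sG3 w : smooth_on X (G3 w) by exact/sL/sL/sf.
pose G4 (w : 'I_N * ('I_N * 'I_N * 'I_N)) := Lie (f w.1) (G3 w.2).
have sG4 w : smooth_on X (G4 w) by exact/sL/sG3.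
have [C3 C30 b3] := locally_bounded_family Xx0 sG3.
have [C4 C40 b4] := locally_bounded_family Xx0 sG4.
have [r /= r0 br] := (nbhs_ballP x0 _).1 (filterI fM (filterI b3 b4)).
exists (Num.max C3 C4); first by rewrite lt_max C30.
exists (r / M); first by rewrite divr_gt0.
move=> t tau x tr x00 tau0 taur s sI.
have xr : `|x s - x 0| < r.
  apply: (trajectory_confined tr (ltW M0) r0 _ _ sI).
    by rewrite mulrC -ltr_pdivlMr.
  move=> y yr l; apply: (br y _).1.
  by rewrite -ball_normE /ball_/= distrC -x00.
have xb : ball x0 r (x s) by rewrite -ball_normE /ball_/= distrC -x00.
have [_ [bx3 bx4]] := br _ xb.
split=> [j i l k|q j i l k]; apply: le_trans (norm_coord_le _ _) _;
  rewrite le_max; apply/orP.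
  by left; exact: (bx3 (j, i, l)).
by right; exact: (bx4 (q, (j, i, l))).
Qed.

(** * Expansions of the endpoint and of the time mean *)

Lemma within_continuous_primitive (R : realType) (q : R -> R) (tau : R) :
  0 < tau -> {within `[0, tau], continuous q} ->
  exists Y : R -> R, [/\ {within `[0, tau], continuous Y}, Y 0 = 0,
    Y tau = \int[lebesgue_measure]_(s in `[0, tau]) q s &
    forall s, s \in `]0, tau[ -> is_derive s 1 Y (q s)].
Proof.
move=> tau0 qc.
have iq : lebesgue_measure.-integrable `[0, tau] (EFin \o q).
  by apply: continuous_compact_integrable => //; exact: segment_compact.
exists (fun s => \int[lebesgue_measure]_(r in `[0, s]) q r); split => //.
- exact: (@parameterized_integral_continuous R 0 tau q (ltW tau0) iq).
- by rewrite set_itv1 Rintegral_set1.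
- move=> s sI; move: (sI); rewrite in_itv/= => /andP[s0 st].
  have [qo _ _] := (continuous_within_itvP q tau0).1 qc.
  have [dY YE] := continuous_FTC1_closed st iq s0 (qo _ sI).
  by split; [exact: dY|rewrite -derive1E; exact: YE].
Qed.

Lemma Rintegral_pw_constant (R : realType) (m N : nat) (t : nat -> R) (tau : R)
    (v : 'I_N -> 'rV[R]_m) (k : 'I_m) :
  switching_times N tau t ->
  \int[lebesgue_measure]_(s in `[0, tau]) pw_constant t v s 0 k =
  \sum_(i < N) duration t i * v i 0 k.
Proof.
move=> [t0 inc tN].
pose J (i : 'I_N) := `[t i, t i.+1[%classic.
have E : (fun s => (pw_constant t v s 0 k)%:E) =
    (fun s => \sum_(i < N) ((v i 0 k)%:E * (\1_(J i) s)%:E))%E.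
  apply/funext => s; rewrite /pw_constant summxE -sumEFin; apply: eq_bigr => i _.
  rewrite -EFinM indicE; congr EFin; rewrite /J mem_setE in_itv/=.
  by case: ifP => _; rewrite ?mulr1// mulr0 mxE.
have mJ i : measurable (J i) by exact: measurable_itv.
have iJ i : lebesgue_measure.-integrable `[0, tau]%classic (fun s => (\1_(J i) s)%:E).
  by apply: (integrableS measurableT) => //; exact: integrable_indic_itv.
rewrite /Rintegral E integral_sum//; last by move=> i; exact: integrableZl.
rewrite (eq_bigr (fun i : 'I_N => (duration t i * v i 0 k)%:E)) ?sumEFin// => i _.
rewrite (integralZl _ (iJ i))// integral_indic//; last exact: mJ.
rewrite setIidl; last first.
  move=> s; rewrite /J /= !in_itv/= => /andP[is_ si].
  have := increasing_upto_le inc (leq0n i) (ltnW (ltn_ord i)).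
  have := increasing_upto_le inc (ltn_ord i) (leqnn N).
  rewrite t0 tN => sN l0; rewrite (le_trans l0 is_)/=.
  exact: le_trans (ltW si) sN.
have LJ : lebesgue_measure (J i) = (duration t i)%:E.
  by rewrite lebesgue_measure_itv/= lte_fin inc.
by apply: etrans (congr1 (mule (v i 0 k)%:E) LJ) _; rewrite -EFinM mulrC.
Qed.

Lemma sum_lower_triangle (R : realType) (N : nat) (i : 'I_N) (F : 'I_N -> R) :
  (forall j : 'I_N, (i < j)%N -> F j = 0) ->
  \sum_(j < N) F j = F i + \sum_(j < N | (j < i)%N) F j.
Proof.
move=> F0; rewrite (bigD1 i)//=; congr (_ + _).
rewrite (bigID (fun j : 'I_N => (j < i)%N))/= [X in _ + X]big1 ?addr0.
  by apply: eq_bigl => j; rewrite -(inj_eq val_inj)/=; case: ltngtP.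
move=> j /andP[ji]; rewrite -leqNgt => ij.
by apply: F0; rewrite ltn_neqAle ij andbT eq_sym.
Qed.

(** At the final time all the elapsed times are complete, and [Vcoef] vanishes
    above the diagonal. *)
Lemma sum_Vcoef_end (R : realType) (N : nat) (t : nat -> R)
    (a : 'I_N -> R) (b : 'I_N -> 'I_N -> R) :
  increasing_upto N t ->
  \sum_(i < N) elapsed t i (t N) * a i
  + \sum_(i < N) \sum_(j < N) Vcoef t i j (t N) * b i j =
  \sum_(i < N) (duration t i * a i + duration t i ^+ 2 / 2 * b i i)
  + \sum_(i < N) \sum_(j < N | (j < i)%N) duration t i * duration t j * b i j.
Proof.
move=> inc; rewrite -!big_split/=; apply: eq_bigr => i _.
rewrite elapsed_end// (@sum_lower_triangle _ _ i); last first.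
  by move=> j ij; rewrite Vcoef_end// ij mul0r.
rewrite Vcoef_end// ltnn eqxx addrA; congr (_ + _).
by apply: eq_bigr => j ji; rewrite Vcoef_end// ltnNge ltnW//= gtn_eqF.
Qed.

(** The fourth order expansion of the identity map; its first Lie derivatives are
    the fields themselves. *)
Lemma endpoint_expansion (R : realType) (n N : nat) (X : set 'rV[R]_n.+1)
    (f : 'I_N -> 'rV[R]_n.+1 -> 'rV[R]_n.+1) (t : nat -> R) (tau : R)
    (x : R -> 'rV[R]_n.+1) (k : 'I_n.+1) (C : R) :
  open X -> (forall l, smooth_on X (f l)) ->
  switched_trajectory X f t tau x -> 0 <= tau -> 0 <= C ->
  (forall q j i l s, s \in `[0, tau] ->
     `|Lie (f q) (Lie (f j) (Lie (f i) (f l))) (x s) 0 k| <= C) ->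
  `|x tau 0 k - (x 0 0 k
      + (\sum_(i < N) (duration t i * f i (x 0) 0 k
          + duration t i ^+ 2 / 2 * Lie (f i) (f i) (x 0) 0 k)
      + \sum_(i < N) \sum_(j < N | (j < i)%N)
          duration t i * duration t j * Lie (f j) (f i) (x 0) 0 k)
      + \sum_(i < N) \sum_(j < N) \sum_(l < N)
          (\int[lebesgue_measure]_(s in `[t l, t l.+1]) Vcoef t i j s)
          * Lie (f j) (Lie (f i) (f l)) (x 0) 0 k)| <= C * tau ^+ 4.
Proof.
move=> oX sf tr tau0 C0 b; have [[t0 inc tN] _ _ _] := tr.
have tauI : tau \in `[0, tau] by rewrite in_itv/= tau0 lexx.
have b' q j i l s : s \in `[0, tau] ->
    `|Lie (f q) (Lie (f j) (Lie (f i) (Lie (f l) id))) (x s) 0 k| <= C.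
  by move=> sI; rewrite Lie_id; exact: b.
have E4 := Lie_expansion4 oX sf tr C0 (@smooth_on_id R n.+1 X) b' tauI.
apply: (eq_ind_r (fun z => `|x tau 0 k - z| <= C * tau ^+ 4) E4).
rewrite -(sum_Vcoef_end _ (fun i j => Lie (f j) (f i) (x 0) 0 k) inc) tN addrA.
apply: congr2; first apply: congr2; first apply: congr1.
- by apply: eq_bigr => i _; rewrite Lie_id.
- by apply: eq_bigr => i _; apply: eq_bigr => j _; rewrite Lie_id.
- apply: eq_bigr => i _; apply: eq_bigr => j _; apply: eq_bigr => l _.
  by rewrite Lie_id -tN Vgated_end.
Qed.

(** The integral of the trajectory and the primitive of its expansion up to third
    order have derivatives that differ by at most [C s^3], hence they differ by
    at most [C tau^4] at the final time. *)
Lemma time_mean_expansion (R : realType) (n N : nat) (X : set 'rV[R]_n.+1)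
    (f : 'I_N -> 'rV[R]_n.+1 -> 'rV[R]_n.+1) (t : nat -> R) (tau : R)
    (x : R -> 'rV[R]_n.+1) (k : 'I_n.+1) (C : R) :
  open X -> (forall l, smooth_on X (f l)) ->
  switched_trajectory X f t tau x -> 0 < tau -> 0 <= C ->
  (forall j i l s, s \in `[0, tau] ->
     `|Lie (f j) (Lie (f i) (f l)) (x s) 0 k| <= C) ->
  `|time_mean tau (fun s => x s 0 k) - (x 0 0 k
      + (1 / (2 * tau)) * (\sum_(i < N)
          (duration t i * (duration t i + 2 * (tau - t i.+1))) * f i (x 0) 0 k)
      + (1 / (6 * tau)) * (\sum_(i < N)
          (duration t i ^+ 2 * (duration t i + 3 * (tau - t i.+1)))
          * Lie (f i) (f i) (x 0) 0 k)
      + (1 / (2 * tau)) * (\sum_(i < N) \sum_(j < N | (j < i)%N)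
          (duration t i * duration t j * (duration t i + 2 * (tau - t i.+1)))
          * Lie (f j) (f i) (x 0) 0 k))| <= C * tau ^+ 3.
Proof.
move=> oX sf tr tau0 C0 b; have [[t0 inc tN] xc xX _] := tr.
have tauI : tau \in `[0, tau] by rewrite in_itv/= (ltW tau0) lexx.
have b' j i l s : s \in `[0, tau] ->
    `|Lie (f j) (Lie (f i) (Lie (f l) id)) (x s) 0 k| <= C.
  by move=> sI; rewrite Lie_id; exact: b.
have dX := smooth_on_differentiable (@smooth_on_id R n.+1 X).
have [Y [cY Y0 Ytau dY]] :=
  within_continuous_primitive tau0 (within_continuous_coord (k := k) dX xc xX).
pose a i := Lie (f i) id (x 0) 0 k.
pose c i j := Lie (f j) (Lie (f i) id) (x 0) 0 k.
(* [Q] is the primitive of the expansion of [x s 0 k] up to third order. *)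
pose Q s := s * x 0 0 k + \sum_(i < N) elapsed_pow_primitive t 1 i s * a i
  + \sum_(i < N) \sum_(j < N) Vprimitive t i j s * c i j.
have cQ : continuous Q.
  move=> s; apply: cvgD; first apply: cvgD.
  - by apply: cvgM; [exact: cvg_id|exact: cvg_cst].
  - apply: continuous_lincomb => i; exact: continuous_elapsed_pow_primitive.
  - apply: continuous_fsum => i; apply: continuous_lincomb => j.
    exact: continuous_Vprimitive.
have Q0 : Y 0 = Q 0.
  have P0 : \sum_(i < N) elapsed_pow_primitive t 1 i 0 * a i = 0.
    by apply: big1 => i _; rewrite (elapsed_pow_primitive0 _ t0 inc)// mul0r.
  have V0 : \sum_(i < N) \sum_(j < N) Vprimitive t i j 0 * c i j = 0.
    apply: big1 => i _; apply: big1 => j _.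
    by rewrite (Vprimitive0 _ t0 inc)// mul0r.
  rewrite Y0; apply: esym.
  by apply: etrans (congr2 +%R (congr1 (+%R _) P0) V0) _; rewrite mul0r !addr0.
have YQ : `|Y tau - Q tau| <= C * tau ^+ 4.
  apply: (@primitive_comparison R Y Q C tau 3 [seq t j | j <- iota 0 N.+1] C0 cY
    (continuous_subspaceT cQ) Q0 _ _ tauI) => s sI sT.
  move: (sI); rewrite in_itv/= => /andP[s0 st].
  have [l [ls sl]] := switching_interval (And3 t0 inc tN) s0 st sT.
  exists (x s 0 k), (x 0 0 k + \sum_(i < N) elapsed t i s * a i
    + \sum_(i < N) \sum_(j < N) Vcoef t i j s * c i j); split.
  - exact: dY.
  - have d1 := is_derive_lincomb a (fun i : 'I_N =>
      is_derive_elapsed_pow_primitive (ltn0Sn 0) inc (ltn_ord i) (ltn_ord l) ls sl).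
    have d2 := is_derive_lincomb (fun ij : 'I_N * 'I_N => c ij.1 ij.2)
      (fun ij : 'I_N * 'I_N => is_derive_Vprimitive ij.2 inc
         (ltn_ord ij.1) (ltn_ord l) ls sl).
    have d0 : is_derive s 1 (fun r : R => r * x 0 0 k) (x 0 0 k).
      have -> : (fun r : R => r * x 0 0 k) = x 0 0 k \*: id.
        by apply/funext => r; rewrite mulrC.
      by apply: is_derive_eq; rewrite /GRing.scale/= mulr1.
    have -> : Q = (fun r : R => r * x 0 0 k)
        + (fun r => \sum_(i < N) elapsed_pow_primitive t 1 i r * a i)
        + (fun r => \sum_(ij : 'I_N * 'I_N) Vprimitive t ij.1 ij.2 r * c ij.1 ij.2).
      by apply/funext => r; rewrite /Q; apply: congr2; [by []|exact: pair_bigA].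
    apply: is_derive_eq (is_deriveD (is_deriveD d0 d1) d2) _.
    apply: congr2; last by apply: esym; exact: pair_bigA.
    by apply: congr1; apply: eq_bigr => i _; rewrite expr1.
  - have sI' : s \in `[0, tau] by rewrite in_itv/= !ltW.
    exact: (Lie_expansion3 oX sf tr C0 (@smooth_on_id R n.+1 X) b' sI').
have QE : Q tau = tau * (x 0 0 k
      + (1 / (2 * tau)) * (\sum_(i < N)
          (duration t i * (duration t i + 2 * (tau - t i.+1))) * f i (x 0) 0 k)
      + (1 / (6 * tau)) * (\sum_(i < N)
          (duration t i ^+ 2 * (duration t i + 3 * (tau - t i.+1)))
          * Lie (f i) (f i) (x 0) 0 k)
      + (1 / (2 * tau)) * (\sum_(i < N) \sum_(j < N | (j < i)%N)
          (duration t i * duration t j * (duration t i + 2 * (tau - t i.+1)))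
          * Lie (f j) (f i) (x 0) 0 k)).
  (* Multiplying by [tau] leaves the values at [tau] of the primitives of
     [elapsed] and [Vcoef], up to the common factors 1/2 and 1/6. *)
  have scaled (y S1 S2 S3 : R) :
      tau * (y + 1 / (2 * tau) * S1 + 1 / (6 * tau) * S2 + 1 / (2 * tau) * S3)
      = tau * y + 2^-1 * S1 + (6^-1 * S2 + 2^-1 * S3).
    by field; exact: lt0r_neq0.
  rewrite scaled /Q; apply: congr2; first apply: congr1.
    rewrite mulr_sumr; apply: eq_bigr => i _.
    rewrite -tN elapsed_pow_primitive_end// /a Lie_id expr1 !mulrA.
    by congr (_ * _); field.
  rewrite !mulr_sumr -big_split/=; apply: eq_bigr => i _.
  have low (j : 'I_N) : (i < j)%N -> Vprimitive t i j tau * c i j = 0.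
    by move=> ij; rewrite /Vprimitive ij mul0r.
  apply: etrans (sum_lower_triangle low) _; apply: congr2.
    rewrite /Vprimitive ltnn eqxx -tN elapsed_pow_primitive_end// /c Lie_id !mulrA.
    by congr (_ * _); field.
  rewrite mulr_sumr; apply: eq_bigr => j ji.
  rewrite /Vprimitive ltnNge ltnW//= gtn_eqF// -tN elapsed_pow_primitive_end//.
  by rewrite /c Lie_id !mulrA; congr (_ * _); field.
rewrite QE in YQ.
have tauN : tau != 0 by exact: lt0r_neq0.
rewrite /time_mean -Ytau -(ler_pM2l tau0) -[X in X * `|_|](gtr0_norm tau0) -normrM.
by rewrite mulrBr mulVKf// mulrCA -exprS.
Qed.

(** * The periodic problem *)

Theorem theorem3p1 (R : realType) (n m N : nat)
    (X : set 'rV[R]_n.+1) (U : set 'rV[R]_m.+1)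
    (f0 : 'rV[R]_n.+1 -> 'rV[R]_n.+1)
    (g : 'I_m.+1 -> 'rV[R]_n.+1 -> 'rV[R]_n.+1)
    (ubar1 : R) (v : 'I_N -> 'rV[R]_m.+1) (x0 : 'rV[R]_n.+1)
    (t : R -> nat -> R) (x : R -> R -> 'rV[R]_n.+1)
    (X_open : open X) (X_connected : connected X)
    (f0_smooth : smooth_on X f0) (g_smooth : forall i, smooth_on X (g i))
    (U_compact : compact U) (X_0 : X 0) (U_0 : U 0) (f0_0 : f0 0 = 0)
    (N_gt0 : (0 < N)%N) (v_U : forall j, U (v j)) (x0_X : X x0) :
  let u := fun tau => pw_constant (t tau) v in
  let A := [set tau : R | 0 < tau /\
    [/\ switching_times N tau (t tau),
        is_solution X f0 g (u tau) tau (x tau),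
        x tau 0 = x0,
        time_mean tau (fun s => u tau s 0 0) = ubar1 &
        x tau 0 = x tau tau]] in
  let F := within A 0^'+ in
  let f := fun i : 'I_N => affine_field f0 g (v i) in
  let d := fun tau => duration (t tau) in
  let xbar := fun tau => \row_(k < n.+1) time_mean tau (fun s => x tau s 0 k) in
  [/\ forall tau, A tau -> \sum_(i < N) d tau i * v i 0 0 = tau * ubar1,
      (fun tau : R =>
         \sum_(i < N) (d tau i *: f i x0
                       + (d tau i ^+ 2 / 2) *: Lie (f i) (f i) x0)
         + \sum_(i < N) \sum_(j < N | (j < i)%N)
             (d tau i * d tau j) *: Lie (f j) (f i) x0
         + \sum_(i < N) \sum_(j < N) \sum_(l < N)
             (\int[lebesgue_measure]_(s in `[t tau l, t tau l.+1])
                Vcoef (t tau) i j s)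
             *: Lie (f j) (Lie (f i) (f l)) x0)
        =O_F (fun tau : R => tau ^+ 4),
      forall tau, A tau ->
        time_mean tau (fun s => x tau s 0 0) = xbar tau 0 0 &
      xbar =
        (fun tau : R =>
           x0
           + (1 / (2 * tau)) *: (\sum_(i < N)
               (d tau i * (d tau i + 2 * (tau - t tau i.+1))) *: f i x0)
           + (1 / (6 * tau)) *: (\sum_(i < N)
               (d tau i ^+ 2 * (d tau i + 3 * (tau - t tau i.+1)))
               *: Lie (f i) (f i) x0)
           + (1 / (2 * tau)) *: (\sum_(i < N) \sum_(j < N | (j < i)%N)
               (d tau i * d tau j * (d tau i + 2 * (tau - t tau i.+1)))
               *: Lie (f j) (f i) x0))
        +O_F (fun tau : R => tau ^+ 3)].
Proof.
move=> u A F f d xbar.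
have sf l : smooth_on X (f l) by exact: smooth_on_affine_field.
have trA tau : A tau -> switched_trajectory X f (t tau) tau (x tau).
  by move=> [_ [st sol _ _ _]]; exact: is_solution_switched st sol.
have [C C0 [delta delta0 bnd]] := short_trajectory_bounds X_open x0_X sf.
have nearF (P : R -> Prop) : (forall tau, A tau -> tau < delta -> P tau) ->
    \forall tau \near F, P tau.
  move=> AP; apply: filterS (nbhs_right_lt delta0) => tau taud Atau.
  exact: AP.
split.
- move=> tau [tau0 [st _ _ mean _]].
  rewrite -(Rintegral_pw_constant v 0 st) -mean /time_mean mulVKf//.
  exact: lt0r_neq0.
- apply/eqO_exP; exists C => //; apply: nearF => tau Atau taud.
  have [tau0 [_ _ x00 _ per]] := Atau; have tr := trA _ Atau.
  have tp : 0 <= tau ^+ 4 by rewrite exprn_ge0// ltW.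
  rewrite (ger0_norm tp); apply: norm_rV_le; first by rewrite mulr_ge0// ltW.
  move=> k; have E4 := endpoint_expansion (k := k) X_open sf tr (ltW tau0) (ltW C0)
    (fun q j i l s sI => (bnd _ _ _ tr x00 tau0 taud s sI).2 q j i l k).
  have cancel (a b c : R) : a - (a + b + c) = - (b + c) by ring.
  rewrite -per x00 cancel normrN in E4.
  apply: (eq_ind_r (fun z => `|z| <= C * tau ^+ 4) E4).
  rewrite !mxE; apply: congr2; first apply: congr2; rewrite summxE.
  + by apply: eq_bigr => i _; rewrite !mxE.
  + by apply: eq_bigr => i _; rewrite summxE; apply: eq_bigr => j _; rewrite !mxE.
  + apply: eq_bigr => i _; rewrite summxE; apply: eq_bigr => j _.
    by rewrite summxE; apply: eq_bigr => l _; rewrite !mxE.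
- by move=> tau _; rewrite mxE.
- apply/eqaddOP/bigO_exP; exists C => //; apply: nearF => tau Atau taud.
  have [tau0 [_ _ x00 _ _]] := Atau; have tr := trA _ Atau.
  have tp : 0 <= tau ^+ 3 by rewrite exprn_ge0// ltW.
  rewrite (ger0_norm tp); apply: norm_rV_le; first by rewrite mulr_ge0// ltW.
  move=> k; have E3 := time_mean_expansion (k := k) X_open sf tr tau0 (ltW C0)
    (fun j i l s sI => (bnd _ _ _ tr x00 tau0 taud s sI).1 j i l k).
  rewrite x00 in E3; apply: (eq_ind_r (fun z => `|z| <= C * tau ^+ 3) E3).
  rewrite !fctE !mxE; apply: congr1; apply: congr1.
  apply: congr2; first apply: congr2; first apply: congr2; first by [].
  + by apply: congr1; rewrite summxE; apply: eq_bigr => i _; rewrite !mxE.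
  + by apply: congr1; rewrite summxE; apply: eq_bigr => i _; rewrite !mxE.
  + apply: congr1; rewrite summxE; apply: eq_bigr => i _.
    by rewrite summxE; apply: eq_bigr => j _; rewrite !mxE.
Qed.
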